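(* Let $n\ge1$ and $c>0$. The inequality $\mathrm{IS}_n(c)$ (respectively $\mathrm{IS}_{n,s}(c)$) holds true as soon as, for all $V\in\mathcal{V}(\mathbb{R}^n)$ (respectively for all even $V\in\mathcal{V}(\mathbb{R}^n)$), \[ H(\eta)+H(\eta^* )\le -n\log(ce^2)+\mathcal{T}(\nu,\nu^* ), \] where $\eta(dx)=\frac1Z e^{-V(x)}\,dx$ and $\eta^*(dx)=\frac1{Z^*}e^{-V^*(x)}\,dx$, with $Z=\int e^{-V}dx$ and $Z^*=\int e^{-V^*}dx$ the normalizing constants, and where $\nu,\nu^*$ are the moment measures of $\eta,\eta^*$.
   Context: $\mathcal{F}(\mathbb{R}^n)$ is the set of convex lower semicontinuous functions $f:\mathbb{R}^n\to\mathbb{R}\cup\{+\infty\}$ taking at least one finite value. The Fenchel-Legendre transform is $f^*(y)=\sup_{x\in\mathbb{R}^n}\{x\cdot y-f(x)\}$. $\mathcal{V}(\mathbb{R}^n)$ is the class of convex functions $V:\mathbb{R}^n\to\mathbb{R}$ such that $V^*$ is also finite everywhere on $\mathbb{R}^n$; for such $V$, both $\int e^{-V}dx$ and $\int e^{-V^*}dx$ are finite (and positive). $\mathrm{IS}_n(c)$ is the statement: for all $f\in\mathcal{F}(\mathbb{R}^n)$ such that $\int e^{-f}dx$ and $\int e^{-f^*}dx$ are both positive, $\int e^{-f}dx\int e^{-f^*}dx\ge c^n$. $\mathrm{IS}_{n,s}(c)$ is the same statement restricted to even functions $f\in\mathcal{F}(\mathbb{R}^n)$. For a probability measure $\eta$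 on $\mathbb{R}^n$ with density proportional to $e^{-V}$, $V$ convex, its moment measure is the pushforward $\nabla V\#\eta$ ($\nabla V$ is defined $\eta$-almost everywhere). Relative entropy: $H(\eta)=\int\log\left(\frac{d\eta}{dx}\right)d\eta$. For Borel probability measures $\mu_1,\mu_2$ on $\mathbb{R}^n$ with finite first moment, $\mathcal{T}(\mu_1,\mu_2)=\inf_{f\in\mathcal{F}(\mathbb{R}^n)}\left\{\int f\,d\mu_1+\int f^*\,d\mu_2\right\}$. *)

(* Defs.v *)
From HB Require Import structures.
From mathcomp Require Import all_boot all_order all_algebra.
From mathcomp Require Import all_classical all_reals all_analysis.

Set Implicit Arguments.
Unset Strict Implicit.
Unset Printing Implicit Defensive.
Import Order.TTheory GRing.Theory Num.Theory.
Import numFieldNormedType.Exports.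
Local Open Scope classical_set_scope.
Local Open Scope ring_scope.

(* Matrices, in particular 'rV[R]_n, carry their Borel sigma-algebra. *)
HB.instance Definition _ (R : realType) (m n : nat) :=
  @isMeasurable.Build (sigma_display (@open 'M[R]_(m, n))) 'M[R]_(m, n)
    <<s @open 'M[R]_(m, n) >>
    (@sigma_algebra0 _ setT _) (@sigma_algebraC _ _)
    (@sigma_algebra_bigcup _ setT _).

Section lebesgue_rV.
Context {R : realType}.

Lemma measurable_coord_rV n (i : 'I_n) :
  measurable_fun [set: 'rV[R]_n] (fun v : 'rV[R]_n => v 0 i).
Proof.
apply: (measurability _ (measurable_realfun.RGenOpens.measurableE R)) => _ [_ [a [b ->]] <-].
rewrite setTI; apply: sub_sigma_algebra.
apply: (@open_comp _ _ (fun v : 'rV[R]_n => v 0 i)); last exact: interval_open.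
by move=> v _; exact: coord_continuous.
Qed.

Lemma measurable_fun_rV d (T : measurableType d) n (f : T -> 'rV[R]_n) :
  (forall i, measurable_fun [set: T] (fun t => f t 0 i)) ->
  measurable_fun [set: T] f.
Proof.
move=> mf; apply: (@measurability _ _ _ 'rV[R]_n _ f (@open 'rV[R]_n) erefl) => _ [U oU <-].
pose box (qr : 'rV[rat]_n * 'rV[rat]_n) : set 'rV[R]_n :=
  [set v | forall i, v 0 i \in `]ratr (qr.1 0 i), ratr (qr.2 0 i)[].
pose F qr : set T := if `[< box qr `<=` U >] then f @^-1` box qr else set0.
have -> : [set: T] `&` f @^-1` U = \bigcup_qr F qr.
  rewrite setTI; apply/seteqP; split=> [t /= Uft|t [qr _]]; last first.
    by rewrite /F; case: asboolP => // + ?; exact.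
  have /nbhs_ballP[e /= e0 eU] : nbhs (f t) U by exact: open_nbhs_nbhs.
  have /choice[q qP] : forall i, exists q : rat,
      ratr q \in `]f t 0 i - e, f t 0 i[.
    by move=> i; apply: rat_in_itvoo; rewrite ltrBlDr ltrDl.
  have /choice[r rP] : forall i, exists r : rat,
      ratr r \in `]f t 0 i, f t 0 i + e[.
    by move=> i; apply: rat_in_itvoo; rewrite ltrDl.
  exists (\row_i q i, \row_i r i) => //; rewrite /F; case: asboolP => [_ i|].
    rewrite /= !mxE in_itv/=.
    by have := qP i; have := rP i; rewrite !in_itv/= => /andP[-> _] /andP[_ ->].
  case=> v /= bv; apply: eU; split => // j i; rewrite (ord1 j).
  have := bv i; rewrite /= !mxE !in_itv/= => /andP[qv vr].
  rewrite /ball/= ltr_distlC.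
  have := qP i; have := rP i; rewrite !in_itv/= => /andP[_ re] /andP[qe _].
  by rewrite (lt_trans qe qv) (lt_trans vr re).
apply: countable_bigcupT_measurable => // qr; rewrite /F.
case: asboolP => // _.
have -> : f @^-1` box qr = \bigcap_(i in [set: 'I_n])
    ([set: T] `&` (fun t => f t 0 i) @^-1`
      `]ratr (qr.1 0 i), ratr (qr.2 0 i)[%classic).
  apply/seteqP; split=> [t /= bt i _|t /= bt i]; first by split=> //; exact: bt.
  by have [] := bt i Logic.I.
apply: fin_bigcap_measurable => // i _; exact: mf.
Qed.

Lemma measurable_box_rV n (a b : 'rV[R]_n) :
  measurable [set v : 'rV[R]_n | forall i, a 0 i <= v 0 i <= b 0 i].
Proof.
have -> : [set v : 'rV[R]_n | forall i, a 0 i <= v 0 i <= b 0 i] =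
    \bigcap_(i in [set: 'I_n])
      ([set: 'rV[R]_n] `&` (fun v => v 0 i) @^-1` `[a 0 i, b 0 i]%classic).
  apply/seteqP; split=> [v /= vab i _|v /= vab i].
    by split=> //=; rewrite in_itv; exact: vab.
  by have [_] := vab i Logic.I; rewrite /= in_itv.
apply: fin_bigcap_measurable => // i _; exact: measurable_coord_rV.
Qed.

Definition rV_cons n (p : 'rV[R]_n * R) : 'rV[R]_n.+1 :=
  \row_(i < n.+1) oapp (fun j => p.1 0 j) p.2 (unlift ord0 i).

Lemma measurable_rV_cons n :
  measurable_fun [set: 'rV[R]_n * measurableTypeR R] (@rV_cons n).
Proof.
apply: measurable_fun_rV => i; under eq_fun do rewrite mxE.
case: unliftP => [j _|_] /=; last exact: measurable_snd.
by apply: (measurableT_comp (measurable_coord_rV j)); exact: measurable_fst.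
Qed.

Definition rV_cons_pushforward n (mu : {measure set 'rV[R]_n -> \bar R}) :
    set 'rV[R]_n.+1 -> \bar R :=
  pushforward (mu \x @lebesgue_measure R)%E (@rV_cons n).

Section rV_cons_pushforward_measure.
Variables (n : nat) (mu : {measure set 'rV[R]_n -> \bar R}).
Let mcons := @measurable_rV_cons n.

Let pf0 : rV_cons_pushforward mu set0 = 0%E.
Proof. exact: measure0. Qed.

Let pf_ge0 A : (0 <= rV_cons_pushforward mu A)%E.
Proof. exact: measure_ge0. Qed.

Let pf_sigma_additive : semi_sigma_additive (rV_cons_pushforward mu).
Proof. exact: measure_semi_sigma_additive. Qed.

HB.instance Definition _ := isMeasure.Build _ _ _ (rV_cons_pushforward mu)
  pf0 pf_ge0 pf_sigma_additive.
End rV_cons_pushforward_measure.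

Fixpoint lebesgue_rV_rec n : {measure set 'rV[R]_n -> \bar R} :=
  if n is m.+1 then rV_cons_pushforward (lebesgue_rV_rec m)
  else dirac (0 : 'rV[R]_0).

Definition lebesgue_rV n : set 'rV[R]_n -> \bar R := lebesgue_rV_rec n.
Arguments lebesgue_rV : clear implicits.

HB.instance Definition _ n :=
  Measure.copy (lebesgue_rV n) (lebesgue_rV_rec n).

Lemma lebesgue_rV_box n (a b : 'rV[R]_n) : (forall i, a 0 i <= b 0 i) ->
  lebesgue_rV n [set v : 'rV[R]_n | forall i, a 0 i <= v 0 i <= b 0 i] =
  (\prod_(i < n) (b 0 i - a 0 i))%:E.
Proof.
rewrite /lebesgue_rV; elim: n a b => [|n IHn] a b ab.
  by rewrite big_ord0 /= diracE mem_set// => -[].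
rewrite big_ord_recl [LHS]/= /rV_cons_pushforward /pushforward.
set a' : 'rV[R]_n := \row_i a 0 (lift ord0 i).
set b' : 'rV[R]_n := \row_i b 0 (lift ord0 i).
have -> : @rV_cons n @^-1` [set v : 'rV[R]_n.+1 | forall i, a 0 i <= v 0 i <= b 0 i] =
    [set v : 'rV[R]_n | forall i, a' 0 i <= v 0 i <= b' 0 i] `*`
    `[a 0 ord0, b 0 ord0].
  apply/seteqP; split => -[v x] /=.
    move=> vx; split=> [i|].
      by have := vx (lift ord0 i); rewrite !mxE liftK.
    by have := vx ord0; rewrite !mxE unlift_none /= in_itv.
  move=> [va xa] i; rewrite mxE.
  case: unliftP => [j ->|->] /=; last by move: xa; rewrite in_itv.
  by have := va j; rewrite !mxE.
rewrite product_measure1E.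
- rewrite IHn => [|i]; last by rewrite !mxE.
  under eq_bigr do rewrite !mxE.
  have leb : lebesgue_measure (`[a 0 ord0, b 0 ord0] : set R) =
      (b 0 ord0 - a 0 ord0)%:E.
    rewrite lebesgue_measure_itv/= lte_fin.
    have := ab ord0; rewrite le_eqVlt => /predU1P[->|->] //.
    by rewrite ltxx subrr.
  by rewrite [X in (_ * X)%E]leb -EFinM mulrC.
- exact: measurable_box_rV.
- exact: measurable_itv.
Qed.

Let lebesgue_rV_sigma_finite n : sigma_finite [set: 'rV[R]_n] (lebesgue_rV n).
Proof.
exists (fun k => [set v : 'rV[R]_n | forall i, - k%:R <= v 0 i <= k%:R]).
  apply/seteqP; split=> // v _.
  exists (Num.truncn (\sum_i `|v 0 i|)).+1 => //= i.
  rewrite -ler_norml (le_trans _ (ltW (truncnS_gt _)))//.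
  by rewrite (bigD1 i)//= lerDl sumr_ge0.
move=> k.
pose a : 'rV[R]_n := const_mx (- k%:R); pose b : 'rV[R]_n := const_mx k%:R.
have -> : [set v : 'rV[R]_n | forall i, - k%:R <= v 0 i <= k%:R] =
    [set v : 'rV[R]_n | forall i, a 0 i <= v 0 i <= b 0 i].
  by apply/seteqP; split=> v /= + i => /(_ i); rewrite !mxE.
split; last first.
  rewrite lebesgue_rV_box ?ltry// => i; rewrite !mxE.
  by rewrite -subr_ge0 opprK addr_ge0.
exact: measurable_box_rV.
Qed.

HB.instance Definition _ n := Measure_isSigmaFinite.Build _ _ _
  (lebesgue_rV n) (@lebesgue_rV_sigma_finite n).

End lebesgue_rV.
Arguments lebesgue_rV : clear implicits.

Section convex_duality.
Context {R : realType} (n : nat).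
Local Notation Rn := 'rV[R]_n.
Local Notation leb := (lebesgue_rV R n).
Local Open Scope ereal_scope.
Implicit Types (f : Rn -> \bar R) (V : Rn -> R).

Definition dot (x y : Rn) : R := (\sum_(i < n) x 0 i * y 0 i)%R.

Definition convex_ereal f := forall (x y : Rn) (t : R), (0 < t < 1)%R ->
  f (t *: x + (1 - t) *: y)%R <= t%:E * f x + (1 - t)%:E * f y.

Definition FRn f :=
  [/\ forall x, f x != -oo, exists x, f x \is a fin_num,
      convex_ereal f & lower_semicontinuous f].

Definition legendre f (y : Rn) : \bar R :=
  ereal_sup (range (fun x => (dot x y)%:E - f x)).

Definition VRn V := convex_function setT V /\
  forall y, legendre (EFin \o V) y \is a fin_num.

(* The transform of a real-valued function, as a real-valued function; the
   truncation [fine] is harmless for V in VRn. *)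
Definition legendreR V (y : Rn) : R := fine (legendre (EFin \o V) y).

Definition expN_integral f : \bar R := \int[leb]_x expeR (- f x).

Definition IS_for (P : set (Rn -> \bar R)) (c : R) := forall f, FRn f -> P f ->
  0 < expN_integral f -> 0 < expN_integral (legendre f) ->
  (c ^+ n)%:E <= expN_integral f * expN_integral (legendre f).

Definition evenf T (f : Rn -> T) := forall x, f (- x)%R = f x.

Definition IS c := IS_for setT c.
Definition ISs c := IS_for (@evenf (\bar R)) c.

(* A relation rather than a function: for V in VRn it determines eta on all
   measurable sets, but building the probability requires Z^-1 e^{-V} to be
   measurable with integral 1. *)
Definition gibbs V (eta : probability Rn R) := forall A, measurable A ->
  eta A = (fine (expN_integral (EFin \o V)))^-1%:E *
          \int[leb]_(x in A) (expR (- V x))%:E.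

Definition gradient V (x : Rn) : Rn := (\row_(i < n) 'D_(delta_mx 0 i) V x)%R.

(* nu is the pushforward of eta by the gradient of V, which is only defined
   where V is differentiable. *)
Definition moment_measure V (eta nu : probability Rn R) :=
  forall A, measurable A ->
    nu A = eta [set x | differentiable V x /\ A (gradient V x)].

Local Open Scope charge_scope.

(* Only meaningful when eta is absolutely continuous: otherwise the library's
   Radon-Nikodym derivative is a default value. *)
Definition entropy (eta : probability Rn R) : \bar R :=
  \int[eta]_x lne (('d (charge_of_finite_measure eta) '/d leb) x).

(* If mu1 and mu2 have finite first moments, both integrals are > -oo, since f
   and its transform have affine minorants; hence no sum is +oo - oo. *)
Definition Tcost (mu1 mu2 : probability Rn R) : \bar R :=
  ereal_inf [set \int[mu1]_x f x + \int[mu2]_y legendre f y | f in FRn].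

End convex_duality.

(* Main.v *)
From HB Require Import structures.
Require Import Defs.
From mathcomp Require Import all_boot all_order all_algebra.
From mathcomp Require Import all_classical all_reals all_analysis.
From mathcomp Require Import measurable_realfun ring lra.
Import Order.TTheory GRing.Theory Num.Theory.
Import numFieldNormedType.Exports.
Local Open Scope classical_set_scope.
Local Open Scope ring_scope.
Set Implicit Arguments.
Unset Strict Implicit.
Unset Printing Implicit Defensive.

(** Let V be finite and convex with finite conjugate W, and let E and E' be the
    means of V and W under their Gibbs measures eta and eta'.  The entropy of
    eta is - E - ln Z.  Since W (grad V x) = x . grad V x - V x, the integral of
    W against the moment measure nu is the eta-mean of x . grad V x - V x, and
    the mean of x . grad V x is n by integration by parts; so this integral is
    n - E, and likewise the integral of V against nu' is n - E'.  As V is the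
    conjugate of W, the function W is a competitor in the transport cost of
    (nu, nu'), which is thus at most 2 n - E - E'.  In the assumed inequality
    the means cancel and what is left is n ln c <= ln Z + ln Z', the inverse
    Santalo inequality for V ([transport_bound_santalo]).

    The bound by n - E ([gibbs_conjugate_mean]) rests on scaling, which is the
    integrated form of this integration by parts.  For r < 1 the elementary bound
    1 + u <= exp u controls the integral of (V x - V (r x)) exp (- V x) by
    (r^-n - 1) Z; dividing by 1 - r and letting r tend to 1 is licit by Fatou's
    lemma, because convexity bounds the difference quotients below by
    V x - V 0.

    A general f with conjugate g is approximated by
      V_k := (conjugate of g + e_k |.|^2) + e_k |.|^2,   with e_k = 1 / (k + 1),
    where |x|^2 stands for x . x, whereas |x| alone is the sup norm.
    Adding a multiple of the squared norm to a convex function makes its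
    conjugate finite and differentiable, with a quadratic upper bound around
    each of its tangent planes ([conj_tangent]).  Hence V_k and its conjugate
    are differentiable everywhere and their moment measures are plain
    pushforwards by the gradient; the predicate [tangent] is the form in which
    this regularity enters every estimate.  Moreover
      V_k >= conjugate of g + e_k |.|^2,
      conjugate of V_k >= conjugate of f + e_k |.|^2,
    and the two right-hand sides increase to f, by biconjugation
    ([biconjugate]), and to g.  So the product of the partition functions of
    V_k and of its conjugate has its upper limit at most that of f and g, by
    dominated convergence ([expN_integral_cvg]).

    The dominating function exp (b - a |x|) comes from [convex_growth]: a convex
    g for which exp (- g) has a positive finite integral grows at least
    linearly.  Then f = conjugate of g is bounded near the origin, and therefore
    the conjugate of f + |.|^2 still grows linearly ([legendre_growth]).  If
    one of the two integrals is infinite, the product is infinite and there is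
    nothing to prove. *)

(** * The dot product and the sup norm *)

Section dot.
Context {R : realType} {n : nat}.
Local Notation Rn := 'rV[R]_n.
Implicit Types (x y z : Rn) (t : R).

Lemma dotC x y : dot x y = dot y x.
Proof. by apply: eq_bigr => i _; rewrite mulrC. Qed.

Lemma dotDl x y z : dot (x + y) z = dot x z + dot y z.
Proof. by rewrite /dot -big_split; apply: eq_bigr => i _; rewrite mxE mulrDl. Qed.

Lemma dotZl t x z : dot (t *: x) z = t * dot x z.
Proof. by rewrite /dot mulr_sumr; apply: eq_bigr => i _; rewrite mxE mulrA. Qed.

Lemma dotDr x y z : dot x (y + z) = dot x y + dot x z.
Proof. by rewrite dotC dotDl !(dotC x). Qed.

Lemma dotZr t x z : dot x (t *: z) = t * dot x z.
Proof. by rewrite dotC dotZl dotC. Qed.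

Lemma dotNl x z : dot (- x) z = - dot x z.
Proof. by rewrite -scaleN1r dotZl mulN1r. Qed.

Lemma dotNr x z : dot x (- z) = - dot x z.
Proof. by rewrite dotC dotNl dotC. Qed.

Lemma dot0l x : dot 0 x = 0.
Proof. by rewrite -(scale0r x) dotZl mul0r. Qed.

Lemma dot0r x : dot x 0 = 0.
Proof. by rewrite dotC dot0l. Qed.

Definition dotE := (dotDl, dotDr, dotNl, dotNr, dotZl, dotZr).

Lemma coord_le_norm x i : `|x 0 i| <= `|x|.
Proof.
rewrite [leRHS]/Num.norm /= mx_normrE.
by apply/bigmax_geP; right => /=; exists (0, i).
Qed.

Lemma norm_le_coord x t : 0 <= t -> (forall i, `|x 0 i| <= t) -> `|x| <= t.
Proof.
move=> t0 xt; rewrite [leLHS]/Num.norm /= mx_normrE.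
by apply/bigmax_leP; split => // -[i j] _ /=; rewrite ord1.
Qed.

Lemma dot_norm_ge x : `|x| ^+ 2 <= dot x x.
Proof.
have d0 : 0 <= dot x x by apply: sumr_ge0 => i _; rewrite -expr2 sqr_ge0.
rewrite -ler_sqrt// sqrtr_sqr ger0_norm//.
apply: norm_le_coord => [|i]; first exact: sqrtr_ge0.
rewrite -sqrtr_sqr ler_sqrt// [leRHS](bigD1 i)//= -expr2 lerDl.
by apply: sumr_ge0 => j _; rewrite -expr2 sqr_ge0.
Qed.

Lemma dot_ge0 x : 0 <= dot x x.
Proof. by apply: sumr_ge0 => i _; rewrite -expr2 sqr_ge0. Qed.

Lemma dot_le_norm x y : `|dot x y| <= n%:R * `|x| * `|y|.
Proof.
apply: (le_trans (ler_norm_sum _ _ _)).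
have -> : n%:R * `|x| * `|y| = \sum_(i < n) (`|x| * `|y|).
  by rewrite sumr_const card_ord -[RHS]mulr_natl mulrA.
by apply: ler_sum => i _; rewrite normrM ler_pM// coord_le_norm.
Qed.

Lemma continuous_dotr y : continuous (fun x : Rn => dot x y).
Proof.
apply: continuous_big => [|i _ x]; first exact: add_continuous.
exact: (cvgM (@coord_continuous R 1 n 0 i x) (cvg_cst _)).
Qed.

Lemma continuous_dotxx : continuous (fun x : Rn => dot x x).
Proof.
apply: continuous_big => [|i _ x]; first exact: add_continuous.
exact: (cvgM (@coord_continuous R 1 n 0 i x) (@coord_continuous R 1 n 0 i x)).
Qed.

End dot.

(** * Minimizers of lower semicontinuous functions *)

Section lsc_min.
Context {R : realType}.
Local Open Scope ereal_scope.

(** If no point of K were a minimizer, every point would have a neighborhood on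
    which phi exceeds one of its values on K; the sublevel sets of phi in K form
    a filter, so compactness makes this uniform and some value of phi on K would
    be smaller than itself. *)
Lemma lsc_compact_min (T : topologicalType) (K : set T) (phi : T -> \bar R) :
  compact K -> K !=set0 -> lower_semicontinuous phi ->
  (forall x, phi x != -oo) ->
  exists2 p, K p & forall x, K x -> phi p <= phi x.
Proof.
move=> cK [z Kz] lphi phiNy; apply: contrapT => nmin.
have lower p : K p -> exists2 x, K x & phi x < phi p.
  move=> Kp; apply: contrapT => nx; apply: nmin; exists p => // x Kx.
  by rewrite leNgt; apply/negP => xp; apply: nx; exists x.
pose F := filter_from K (fun u => [set y | K y /\ phi y <= phi u]).
have FF : Filter F.
  apply: filter_from_filter; first by exists z.
  move=> u v Ku Kv; have [uv|vu] := leP (phi u) (phi v).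
    by exists u => // y [Ky yu]; split; split => //; exact: le_trans uv.
  by exists v => // y [Ky yv]; split; split => //; exact: le_trans (ltW vu).
have /compact_near_coveringP := cK.
move=> /(_ T F (fun y x => phi y < phi x) FF)[p Kp|u Ku Fu].
  have [x Kx xp] := lower p Kp.
  have xfin : phi x \is a fin_num.
    by rewrite fin_numE phiNy lt_eqF// (lt_le_trans xp)// leey.
  have [V pV Vphi] := lphi p (fine (phi x)) (ltac:(by rewrite fineK)).
  exists (V, [set y | K y /\ phi y <= phi x]) => /=.
    by split => //; exists x.
  move=> [x' y] /= [Vx' [_ yx]]; apply: le_lt_trans yx _.
  by rewrite -(fineK xfin); exact: Vphi.
by have := Fu u (conj Ku (lexx _)) u Ku; rewrite ltxx.
Qed.

Lemma lsc_coercive_min n (phi : 'rV[R]_n -> \bar R) (x1 : 'rV[R]_n) (c2 c1 c0 : R) :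
  lower_semicontinuous phi -> phi x1 < +oo -> (0 < c2)%R ->
  (forall x, (c2 * `|x| ^+ 2 - c1 * `|x| - c0)%:E <= phi x) ->
  exists p, forall x, phi p <= phi x.
Proof.
move=> lphi fx1 c20 phige.
have phiNy x : phi x != -oo by rewrite gt_eqF// (lt_le_trans _ (phige x))// ltNyr.
have fin1 : phi x1 \is a fin_num by rewrite fin_numE phiNy lt_eqF.
set r := fine (phi x1).
pose rho := (`|x1| + 1 + (`|c1| + `|r + c0|) / c2)%R.
pose K := [set x : 'rV[R]_n | forall i, x ord0 i \in `[(- rho)%R, rho]].
have rho0 : (0 <= rho)%R by rewrite /rho !addr_ge0// divr_ge0// ?addr_ge0// ltW.
have KP x : (`|x| <= rho)%R -> K x.
  move=> xrho i; rewrite in_itv /= -ler_norml.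
  exact: le_trans (coord_le_norm _ _) xrho.
have q0 : (0 <= (`|c1| + `|r + c0|) / c2)%R by rewrite divr_ge0// ltW.
have Kx1 : K x1 by apply: KP; rewrite /rho -addrA lerDl addr_ge0.
have cK : compact K.
  apply: (@rV_compact _ _ (fun=> `[(- rho)%R, rho]%classic)) => _.
  exact: segment_compact.
have [p Kp pmin] := lsc_compact_min cK (ex_intro _ _ Kx1) lphi phiNy.
exists p => x; have [Kx|Kx] := leP `|x|%R rho; first exact: pmin (KP _ Kx).
apply: le_trans (pmin _ Kx1) _; rewrite -(fineK fin1) -/r.
apply: le_trans (phige x); rewrite lee_fin.
have x1ge0 := normr_ge0 x1.
have s1 : (1 <= `|x|)%R by move: Kx; rewrite /rho; lra.
have h : (`|c1| + `|r + c0| <= c2 * `|x|)%R.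
  by rewrite -ler_pdivrMl// mulrC; move: Kx; rewrite /rho; lra.
have h2 : ((`|c1| + `|r + c0|) * `|x| <= c2 * `|x| ^+ 2)%R.
  by rewrite expr2 mulrA ler_wpM2r.
have h3 : (`|r + c0| <= `|r + c0| * `|x|)%R by rewrite ler_peMr.
have h4 : (c1 * `|x| <= `|c1| * `|x|)%R by rewrite ler_wpM2r// ler_norm.
have h5 := ler_norm (r + c0).
lra.
Qed.

End lsc_min.

(** * Conjugates of strongly convex functions *)

Section tangent.
Context {R : realType} {n : nat}.
Local Notation Rn := 'rV[R]_n.
Local Open Scope ereal_scope.
Implicit Types (V W : Rn -> R) (f g : Rn -> \bar R) (p : Rn -> Rn).

(** V touches each of its tangent planes to second order: it lies above the plane
    of slope [p x] at x and exceeds it by at most C |v|^2.  The lower bound is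
    convexity, the upper one replaces a bound on the second derivative, and [p]
    turns out to be the gradient ([tangent_gradient]). *)
Definition tangent V p (C : R) := forall x v,
  (V x + dot v (p x) <= V (x + v) <= V x + dot v (p x) + C * dot v v)%R.

Definition add_quad (e : R) g (x : Rn) : \bar R := g x + (e * dot x x)%:E.

Definition affine_minorant g (y0 : Rn) (c : R) := forall x, (dot x y0 - c)%:E <= g x.

Lemma legendre_ge g x y : (dot x y)%:E - g x <= legendre g y.
Proof. by apply: ereal_sup_ubound; exists x. Qed.

Lemma legendre_le g y m : (forall x, (dot x y)%:E - g x <= m) -> legendre g y <= m.
Proof. by move=> h; apply: ge_ereal_sup => _ [x _ <-]. Qed.

Lemma legendre_le_affine g y (m : R) :
  (forall x, (dot x y - m)%:E <= g x) -> legendre g y <= m%:E.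
Proof.
move=> h; apply: legendre_le => x; move: (h x).
case: (g x) => [r| |] //=; last by rewrite leNye.
by rewrite -EFinB !lee_fin; lra.
Qed.

Lemma le_legendre f g y : (forall x, f x <= g x) -> legendre g y <= legendre f y.
Proof.
move=> fg; apply: legendre_le => x; apply: le_trans (legendre_ge f x y).
by rewrite leeB.
Qed.

Lemma lsc_addR f (h : Rn -> R) : lower_semicontinuous f -> continuous h ->
  lower_semicontinuous (fun x => f x + (h x)%:E).
Proof.
move=> lf ch x a ax.
have [b [bf bh]] : exists b, b%:E < f x /\ (a - b < h x)%R.
  have [fy|fNy] := eqVneq (f x) +oo.
    exists (a - h x + 1)%R; rewrite fy ltry; split => //; lra.
  have [fNNy|fNNy] := eqVneq (f x) -oo; first by move: ax; rewrite fNNy.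
  have ffin : f x \is a fin_num by rewrite fin_numE fNNy.
  move: ax; rewrite -(fineK ffin) -EFinD lte_fin => ax.
  by exists ((fine (f x) + (a - h x)) / 2)%R; rewrite lte_fin; split; lra.
have [U xU Uf] := lf _ _ bf.
exists (U `&` [set y | a - b < h y]%R).
  apply: filterI => //; apply: (ch x [set t | a - b < t]%R).
  exact: (open_nbhs_nbhs (conj (@open_gt _ _) bh)).
move=> y [/Uf bfy /= bhy]; have -> : a%:E = b%:E + (a - b)%:E.
  by rewrite -EFinD addrC subrK.
apply: lteD => //.
Qed.

Section conj.
Variables (g : Rn -> \bar R) (y0 : Rn) (c : R) (x1 : Rn).
Hypothesis lg : lower_semicontinuous g.
Hypothesis cg : convex_ereal g.
Hypothesis ag : affine_minorant g y0 c.
Hypothesis g1 : g x1 < +oo.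

Lemma minorant_gtNy x : g x != -oo.
Proof. by rewrite gt_eqF// (lt_le_trans _ (ag x))// ltNyr. Qed.

(** [p] minimizes g + e |.|^2 - . y, and the quadratic term makes the minimum
    strong: comparing the values at p and at the midpoint of p and x gains
    e / 2 |x - p|^2. *)
Lemma add_quad_min (e : R) (y : Rn) : (0 < e)%R -> exists p : Rn, g p \is a fin_num /\
  forall x, (fine (g p) + e * dot p p + dot (x - p) y + e / 2 * dot (x - p) (x - p))%:E
     <= add_quad e g x.
Proof.
move=> e0.
pose phi x := add_quad e g x + (- dot x y)%:E.
have lphi : lower_semicontinuous phi.
  apply: lsc_addR; first apply: lsc_addR => //.
    by move=> x; exact: (cvgM (cvg_cst _) (@continuous_dotxx R n x)).
  by move=> x; exact: (cvgN (@continuous_dotr R n y x)).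
have phi1 : phi x1 < +oo.
  have fin1 : g x1 \is a fin_num by rewrite fin_numE minorant_gtNy lt_eqF.
  by rewrite /phi /add_quad -(fineK fin1) ltry.
have [p pmin] : exists p : Rn, forall x, phi p <= phi x.
  apply: (@lsc_coercive_min _ _ phi x1 e (n%:R * `|y0 - y|)%R c lphi phi1 e0) => x.
  apply: le_trans (leeD (leeD (ag x) (lexx _)) (lexx _)).
  rewrite -!EFinD lee_fin.
  have h1 := dot_norm_ge x; have h2 := dot_le_norm x (y0 - y).
  have h3 : (e * `|x| ^+ 2 <= e * dot x x)%R by rewrite ler_wpM2l// ltW.
  have h4 : (- dot x (y0 - y) <= `|dot x (y0 - y)|)%R by rewrite -normrN ler_norm.
  have h5 : dot x (y0 - y) = (dot x y0 - dot x y)%R by rewrite dotDr dotNr.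
  rewrite mulrAC in h2; lra.
have gp : g p \is a fin_num.
  rewrite fin_numE minorant_gtNy; apply/negP => /eqP gpy.
  by have := le_lt_trans (pmin x1) phi1; rewrite /phi /add_quad gpy.
exists p; split => // x.
have [gx|gx] := eqVneq (g x) +oo; first by rewrite /add_quad gx leey.
have gxf : g x \is a fin_num by rewrite fin_numE minorant_gtNy.
pose m := (2^-1 *: x + (1 - 2^-1) *: p)%R.
have hm : g m <= (2^-1)%:E * g x + (1 - 2^-1)%:E * g p by apply: cg; lra.
have gm : g m \is a fin_num.
  rewrite fin_numE minorant_gtNy lt_eqF// (le_lt_trans hm)//.
  by rewrite -(fineK gp) -(fineK gxf) ltry.
have := pmin m; move: hm; rewrite /phi /add_quad -(fineK gp) -(fineK gxf) -(fineK gm).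
rewrite -!EFinD !lee_fin.
move: (fine _) (fine _) (fine _) => a b d.
rewrite /m !dotE (dotC p x); move: (dot x x) (dot x p) (dot p p) (dot x y) (dot p y).
move=> xx xp pp xy py.
have -> : (1 - 2^-1 = 2^-1 :> R)%R by lra.
rewrite /=; lra.
Qed.

(** Strong convexity on the primal side is smoothness on the dual side.  At y the
    supremum is attained at the strong minimizer [p y] of [add_quad_min]; keeping
    this competitor at y + v gives the lower bound, and the gain
    e / 2 |x - p y|^2 absorbs the cross term v . (x - p y) in the upper bound, at
    the cost of |v|^2 / (2 e). *)
Lemma conj_tangent (e : R) : (0 < e)%R -> exists W p,
  legendre (add_quad e g) = EFin \o W /\ tangent W p (2 * e)^-1.
Proof.
move=> e0.
have /choice[p pP] := fun y => add_quad_min y e0.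
pose W y := (dot (p y) y - (fine (g (p y)) + e * dot (p y) (p y)))%R.
have GW : legendre (add_quad e g) = EFin \o W.
  apply/funext => y; apply/eqP; rewrite eq_le; have [gp pm] := pP y.
  apply/andP; split.
    apply: legendre_le_affine => x; apply: le_trans (pm x); rewrite lee_fin.
    have : (0 <= e / 2 * dot (x - p y) (x - p y))%R.
      by rewrite mulr_ge0 ?dot_ge0// divr_ge0// ltW.
    by rewrite /W (dotDl _ _ y) dotNl; lra.
  apply: le_trans (legendre_ge (add_quad e g) (p y) y).
  by rewrite /add_quad -(fineK gp) /= lee_fin.
exists W, p; split => //.
move=> y v; have [gp pm] := pP y; apply/andP; split.
  have := legendre_ge (add_quad e g) (p y) (y + v).
  rewrite GW /add_quad -(fineK gp) /= lee_fin => h; apply: le_trans h.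
  by rewrite /W dotDr (dotC v); lra.
rewrite -lee_fin -[leLHS]/((EFin \o W) (y + v)%R) -GW.
apply: legendre_le_affine => x; apply: le_trans (pm x); rewrite lee_fin /W.
(* the square that completes v . (x - p y) against e / 2 |x - p y|^2 *)
have h := dot_ge0 (e *: (x - p y) - v).
have e2 : (0 < (2 * e)^-1)%R by rewrite invr_gt0 mulr_gt0.
have {h} : (0 <= (2 * e)^-1 * dot (e *: (x - p y) - v) (e *: (x - p y) - v))%R.
  by rewrite mulr_ge0// ltW.
rewrite !dotE (dotC v x) (dotC v (p y)) (dotC (p y) x).
move: (dot _ _) (dot _ _) (dot _ _) (dot _ _)
  (dot _ _) (dot _ _) (dot _ _) (dot _ _) (fine _).
move=> A B D E F G H I J.
set k := (2 * e)^-1%R.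
have ke : (k * e = 2^-1)%R by rewrite /k invfM -mulrA mulVf ?mulr1 ?gt_eqF.
have -> : (k * (e * (e * (I - H) - G - (e * (H - F) - E)) - (e * (G - E) - D)) =
  k * e * (e * (I - H) - e * (H - F) - (G - E) - (G - E)) + k * D)%R by ring.
by rewrite ke; lra.
Qed.

End conj.
End tangent.

(** * Functions with quadratic contact to their tangent planes *)

Section tangent_theory.
Context {R : realType} {n : nat}.
Local Notation Rn := 'rV[R]_n.
Implicit Types (x y v : Rn).

(** A name for v |-> v . w, so that a linear structure can be declared on it. *)
Definition dotr (w v : Rn) : R := dot v w.

Lemma dotr_is_linear w : linear (dotr w).
Proof. by move=> a u v; rewrite /dotr dotDl dotZl. Qed.

HB.instance Definition _ (w : Rn) :=
  @GRing.isLinear.Build R Rn R _ (dotr w) (dotr_is_linear w).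

Section fixed.
Variables (V : Rn -> R) (p : Rn -> Rn) (C : R).
Hypothesis tV : tangent V p C.

(** The remainder V (x + v) - V x - v . p x lies between 0 and C |v|^2. *)
Lemma tangent_is_diff x : differentiable V x /\ 'd V x = dotr (p x) :> (Rn -> R).
Proof.
have dotrc : continuous (dotr (p x)) by exact: continuous_dotr.
have expand : (V : Rn -> (R : normedModType R)) \o shift x =
    cst (V x : (R : normedModType R)) +
    (dotr (p x) : Rn -> (R : normedModType R)) +o_ (0 : Rn) id.
  apply/eqaddoP => _/posnumP[e]; near=> v.
  change (`|V (v + x) - (V x + dot v (p x))| <= e%:num * `|v|).
  have /andP[h1 h2] := tV x v.
  rewrite (addrC v) ger0_norm ?subr_ge0//.
  have h3 : C * dot v v <= `|C| * (n%:R * `|v| * `|v|).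
    by rewrite (le_trans (ler_norm _))// normrM ler_wpM2l// dot_le_norm.
  apply: (@le_trans _ _ (C * dot v v)); first by lra.
  apply: le_trans h3 _.
  rewrite mulrA ler_wpM2r// mulrA.
  have : `|v| <= e%:num / (`|C| * n%:R + 1).
    near: v; apply: (@cvgr0_norm_le _ _ _ _ _ id); first exact: cvg_id.
    by rewrite divr_gt0// ltr_wpDl// mulr_ge0.
  have c1 : 0 < `|C| * n%:R + 1 by rewrite ltr_wpDl// mulr_ge0.
  rewrite ler_pdivlMr// => /(le_trans _); apply.
  by rewrite mulrC ler_wpM2l// lerDl.
have dV := diff_unique dotrc expand.
split=> //; apply/diff_locallyP; rewrite dV; split=> //; exact: expand.
Unshelve. all: by end_near. Qed.

Lemma tangent_continuous : continuous V.
Proof.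
by move=> x; apply/differentiable_continuous; have [] := tangent_is_diff x.
Qed.

Lemma tangent_gradient : gradient V = p.
Proof.
apply/funext => x; apply/rowP => i; rewrite mxE.
have [dV dVE] := tangent_is_diff x.
rewrite deriveE// dVE /dotr /dot (bigD1 i)//= big1 ?addr0 => [|j ji].
  by rewrite !mxE !eqxx mul1r.
by rewrite mxE (negbTE ji) andbF mul0r.
Qed.

Lemma tangent_convex x y t : 0 <= t -> t <= 1 ->
  V (t *: x + (1 - t) *: y) <= t * V x + (1 - t) * V y.
Proof.
move=> t0 t1; set z := t *: x + (1 - t) *: y.
have /andP[hx _] := tV z (x - z); have /andP[hy _] := tV z (y - z).
rewrite !subrKC in hx hy.
have t1' : 0 <= 1 - t by lra.
have := ler_wpM2l t0 hx; have := ler_wpM2l t1' hy.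
suff : t * dot (x - z) (p z) + (1 - t) * dot (y - z) (p z) = 0 by lra.
by rewrite /z !dotE; ring.
Qed.

Lemma tangent_convex_function : convex_function setT V.
Proof.
move=> t x y _ _; apply: tangent_convex; first by [].
by have := le1 t.
Qed.

Lemma tangent_FRn : FRn (EFin \o V).
Proof.
split => //.
- by exists 0.
- move=> x y t /andP[t0 t1]; rewrite /= -!EFinM -EFinD lee_fin.
  by apply: tangent_convex; exact: ltW.
- move=> x a /=; rewrite lte_fin => ax.
  exists [set y | a < V y]; last by move=> y /=; rewrite lte_fin.
  exact: (@tangent_continuous x _ (open_nbhs_nbhs (conj (@open_gt _ _) ax))).
Qed.

(** Equality case of the Fenchel-Young inequality: the tangent plane at x
    supports V. *)
Lemma tangent_legendre x :
  legendre (EFin \o V) (p x) = (dot x (p x) - V x)%:E.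
Proof.
apply/eqP; rewrite eq_le; apply/andP; split.
  apply: legendre_le_affine => z; rewrite lee_fin.
  have /andP[h _] := tV x (z - x).
  by rewrite subrKC dotDl dotNl in h; lra.
exact: (legendre_ge (EFin \o V) x (p x)).
Qed.

Lemma tangent_add_quad e : 0 <= e -> tangent (fun x => V x + e * dot x x)
  (fun x => p x + (2 * e) *: x) (C + e).
Proof.
move=> e0 x v; have /andP[h1 h2] := tV x v.
have := mulr_ge0 e0 (dot_ge0 v).
by rewrite !dotE (dotC x v) => ev; apply/andP; split; lra.
Qed.

End fixed.

Lemma legendre_gtNy (f : Rn -> \bar R) x1 y : (f x1 < +oo -> legendre f y != -oo)%E.
Proof.
move=> f1; rewrite gt_eqF// (lt_le_trans _ (legendre_ge f x1 y))//.
by case: (f x1) f1 => [r| |]//= _; rewrite -EFinB ltNyr.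
Qed.

Lemma legendre_minorant (f : Rn -> \bar R) x1 : f x1 \is a fin_num ->
  affine_minorant (legendre f) x1 (fine (f x1)).
Proof.
move=> f1 y; have := legendre_ge f x1 y.
by rewrite -(fineK f1) /= dotC.
Qed.

Lemma legendre_lsc (f : Rn -> \bar R) : lower_semicontinuous (legendre f).
Proof.
move=> y a; rewrite /legendre => /ereal_sup_gt[_ [x _ <-]] ax.
exists [set z | (a%:E < (dot x z)%:E - f x)%E]; last first.
  by move=> z /= /lt_le_trans; apply; exact: legendre_ge.
case: (f x) ax => [r| |] /=.
- rewrite -EFinB lte_fin => ax.
  have cd : continuous (fun z : Rn => dot x z - r).
    have -> : (fun z : Rn => dot x z - r) = (fun z => dot z x - r).
      by apply/funext => z; rewrite dotC.
    by move=> z; exact: (cvgB (@continuous_dotr R n x z) (cvg_cst _)).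
  have h : nbhs y [set z | a < dot x z - r].
    exact: (cd y [set t | a < t] (open_nbhs_nbhs (conj (@open_gt _ _) ax))).
  by apply: filterS h => z /=; rewrite -EFinB lte_fin.
- by [].
- by move=> _; apply: filterS filterT => z _ /=; rewrite ltry.
Qed.

Lemma legendre_convex (f : Rn -> \bar R) x1 : (f x1 < +oo)%E ->
  convex_ereal (legendre f).
Proof.
move=> f1 y z t /andP[t0 t1].
have t1' : 0 < 1 - t by rewrite subr_gt0.
have Ny u := legendre_gtNy u f1.
have gty (s : R) (w : \bar R) : 0 < s -> w = +oo%E -> (s%:E * w = +oo)%E.
  by move=> s0 ->; rewrite gt0_muley// lte_fin.
have [ly|ly] := eqVneq (legendre f y) +oo%E.
  rewrite (gty _ _ t0 ly) addye ?leey//.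
  have := Ny z; case: (legendre f z) => [r| |]//= _.
  by rewrite (gty _ _ t1' erefl).
have [lz|lz] := eqVneq (legendre f z) +oo%E.
  rewrite (gty _ _ t1' lz) addey ?leey//.
  by have := Ny y; case: (legendre f y) ly.
have fy : legendre f y \is a fin_num by rewrite fin_numE Ny.
have fz : legendre f z \is a fin_num by rewrite fin_numE Ny.
rewrite -(fineK fy) -(fineK fz) -!EFinM -EFinD; apply: legendre_le_affine => x.
have := legendre_ge f x y; have := legendre_ge f x z.
rewrite -(fineK fy) -(fineK fz).
case: (f x) => [r| |]//=; last by rewrite leey.
rewrite !dotE !lee_fin => hz hy.
have := ler_wpM2l (ltW t0) hy; have := ler_wpM2l (ltW t1') hz; lra.
Qed.

Lemma legendre_even (f : Rn -> \bar R) : evenf f -> evenf (legendre f).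
Proof.
move=> ef; have le y : (legendre f (- y) <= legendre f y)%E.
  apply: legendre_le => x; apply: le_trans (legendre_ge f (- x) y).
  by rewrite ef dotNl dotNr.
by move=> y; apply/eqP; rewrite eq_le le/= -{1}(opprK y) le.
Qed.

End tangent_theory.

(** * Biconjugation *)

Section biconjugate.
Context {R : realType} {n : nat}.
Local Notation Rn := 'rV[R]_n.
Local Open Scope ereal_scope.
Variables (f : Rn -> \bar R) (y0 : Rn) (c : R) (x1 : Rn).
Hypothesis lf : lower_semicontinuous f.
Hypothesis cf : convex_ereal f.
Hypothesis af : affine_minorant f y0 c.
Hypothesis f1 : f x1 < +oo.

(** The proximal point p of x0 minimizes f + k |. - x0|^2; moving from p towards z
    by a small fraction t, convexity of f and minimality leave an error of order
    t, so 2 k (x0 - p) is a subgradient of f at p. *)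
Lemma prox_subgradient (k : R) (x0 : Rn) : (0 < k)%R ->
  exists p : Rn, f p \is a fin_num /\
    forall z, (fine (f p) + dot (z - p) ((2 * k) *: (x0 - p)))%:E <= f z.
Proof.
move=> k0; have [p [fp pmin]] := add_quad_min lf cf af f1 ((2 * k) *: x0) k0.
exists p; split=> // z.
have [fz|fz] := eqVneq (f z) +oo; first by rewrite fz leey.
have Ny x : f x != -oo by exact: minorant_gtNy af _.
have fzf : f z \is a fin_num by rewrite fin_numE Ny.
rewrite -(fineK fzf) lee_fin; apply/ler_addgt0Pr => e e0.
pose d := dot (z - p) (z - p).
have d0 : (0 <= d)%R := dot_ge0 _.
(* small enough for the error t k d to be at most e, and never above 1 *)
pose t := (e / (e + k * d))%R.
have den0 : (0 < e + k * d)%R by rewrite ltr_pwDl// mulr_ge0// ltW.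
have t0 : (0 < t)%R by rewrite divr_gt0.
have t1 : (t <= 1)%R by rewrite ler_pdivrMr// mul1r lerDl mulr_ge0// ltW.
have tkd : (t * (k * d) <= e)%R.
  by rewrite /t mulrAC ler_pdivrMr// ler_wpM2l ?lerDr ?ltW.
pose m := (t *: z + (1 - t) *: p)%R.
have hm : f m <= t%:E * f z + (1 - t)%:E * f p.
  have [t1'|t1'] := eqVneq t 1%R.
    rewrite /m t1' subrr scale0r addr0 scale1r mul1e mul0e adde0//.
  by apply: cf; rewrite t0 lt_neqAle t1' t1.
have fm : f m \is a fin_num.
  rewrite fin_numE Ny lt_eqF// (le_lt_trans hm)//.
  by rewrite -(fineK fp) -(fineK fzf) ltry.
have := pmin m; move: hm; rewrite /add_quad -(fineK fp) -(fineK fzf) -(fineK fm).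
rewrite -!EFinM -!EFinD !lee_fin.
have mp : (m - p = t *: (z - p))%R.
  by rewrite /m scalerBl scale1r scalerBr -addrA [(p - _ - _)%R]addrAC subrr sub0r.
have mE : m = (p + t *: (z - p))%R by rewrite -mp subrKC.
have -> : dot m m = (dot p p + 2 * t * dot (z - p) p + t ^+ 2 * d)%R.
  rewrite mE dotDl !dotDr !dotZl !dotZr (dotC p) -/d; ring.
rewrite mp !dotZl !dotZr -/d (dotDr _ x0) dotNr.
move: (dot _ x0) (dot _ p) (dot p p) => A B D /=.
move: (fine (f m)) (fine (f z)) (fine (f p)) => F G H h1 h2.
have td : (0 <= k / 2 * (t * (t * d)))%R.
  apply: mulr_ge0; first by rewrite divr_ge0// ltW.
  by do 2 (apply: mulr_ge0; first exact: ltW).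
rewrite -(ler_pM2l t0).
have := ler_wpM2l (ltW t0) tkd.
rewrite expr2 in h2; lra.
Qed.

(** Fenchel-Moreau.  The affine minorant of f supported at the proximal point p of
    x0 shows that the biconjugate at x0 is at least f p + 2 k |x0 - p|^2.  For
    large k this exceeds any number below f x0: either p is close to x0 and lower
    semicontinuity applies, or the quadratic term beats the given affine
    minorant. *)
Lemma biconjugate : legendre (legendre f) = f.
Proof.
apply/funext => x0; apply/eqP; rewrite eq_le; apply/andP; split.
  apply: legendre_le => y; rewrite dotC.
  have [fx|fx] := eqVneq (f x0) +oo; first by rewrite fx leey.
  have fxf : f x0 \is a fin_num by rewrite fin_numE fx (minorant_gtNy af).
  have := legendre_ge f x0 y.
  have := legendre_gtNy y f1.
  rewrite -(fineK fxf); case: (legendre f y) => [r| |] //= _; rewrite ?leNye//.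
  by rewrite !lee_fin; lra.
rewrite leNgt; apply/negP => lt0.
have lower : forall k : R, (0 < k)%R -> exists p : Rn, f p \is a fin_num /\
   (fine (f p) + 2 * k * dot (x0 - p) (x0 - p))%:E <= legendre (legendre f) x0.
  move=> k k0; have [p [fp ps]] := prox_subgradient x0 k0.
  exists p; split => //.
  set w := ((2 * k) *: (x0 - p))%R in ps.
  have lw : legendre f w <= (dot p w - fine (f p))%:E.
    apply: legendre_le_affine => z; apply: le_trans (ps z).
    by rewrite lee_fin dotDl dotNl; lra.
  apply: le_trans (legendre_ge _ w x0).
  apply: le_trans (leeB (lexx _) lw).
  rewrite -EFinB lee_fin (dotC w) /w !dotZr !dotE (dotC x0 p); lra.
have lNy : -oo < legendre (legendre f) x0.
  have [p [fp]] := lower _ ltr01; apply: lt_le_trans; exact: ltNyr.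
have lfin : legendre (legendre f) x0 \is a fin_num.
  by rewrite fin_numE gt_eqF//= lt_eqF// (lt_le_trans lt0)// leey.
set a := fine (legendre (legendre f) x0).
have aE : legendre (legendre f) x0 = a%:E by rewrite fineK.
rewrite aE in lt0 lower.
have [U xU Uf] := lf lt0.
have /nbhs_ballP[d /= d0 dU] := xU.
pose A0 := (dot x0 y0 - c)%R; pose B := (n%:R * `|y0|)%R.
have B0 : (0 <= B)%R by rewrite mulr_ge0.
(* for s >= d this k gives k s^2 >= B s + |a| + |A0| + 1 *)
pose k := ((B + (`|a| + `|A0| + 1) / d) / d)%R.
have num0 : (0 < `|a| + `|A0| + 1)%R by rewrite ltr_wpDl// addr_ge0.
have k0 : (0 < k)%R by rewrite divr_gt0// ltr_wpDl// divr_gt0.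
have [p [fp]] := lower k k0; rewrite lee_fin => pa.
have dge := dot_norm_ge (x0 - p).
have kd0 : (0 <= k * dot (x0 - p) (x0 - p))%R by rewrite mulr_ge0 ?dot_ge0 ?ltW.
have [pd|pd] := ltP `|x0 - p|%R d.
  have : a%:E < f p by apply: Uf; apply: dU; rewrite -ball_normE.
  by rewrite -(fineK fp) lte_fin; lra.
have : (fine (f p) >= A0 - B * `|x0 - p|)%R.
  rewrite -lee_fin (fineK fp); apply: le_trans (af p); rewrite lee_fin /A0 /B.
  have := dot_le_norm (x0 - p) y0; rewrite mulrAC => h.
  have := ler_norm (dot (x0 - p) y0); rewrite dotDl dotNl in h *; lra.
set s := `|x0 - p|%R in pd dge *.
have h1 : (k * s ^+ 2 <= k * dot (x0 - p) (x0 - p))%R by rewrite ler_wpM2l// ltW.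
have h2 : (B + (`|a| + `|A0| + 1) / d <= k * s)%R.
  by rewrite -[leLHS](divfK (lt0r_neq0 d0)) ler_wpM2l// ltW.
have s0 : (0 <= s)%R by exact: normr_ge0.
have := ler_wpM2r s0 h2; have -> : (k * s * s = k * s ^+ 2)%R by rewrite expr2 mulrA.
rewrite mulrDl.
have h3 : ((`|a| + `|A0| + 1) <= (`|a| + `|A0| + 1) / d * s)%R.
  by rewrite mulrAC ler_pdivlMr// ler_wpM2l// ltW.
have := ler_norm a; have := ler_norm (- A0); rewrite normrN.
lra.
Qed.

End biconjugate.

(** * Affine changes of variables for Lebesgue measure *)

Section box_generation.
Context {R : realType} {n : nat}.
Local Notation Rn := 'rV[R]_n.

Definition box (a b : Rn) : set Rn := [set v : Rn | forall i, a 0 i <= v 0 i <= b 0 i].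

Definition boxes : set (set Rn) := [set B | exists a b, B = box a b].

Lemma boxesI : setI_closed boxes.
Proof.
move=> _ _ [a [b ->]] [c [d ->]].
exists (\row_i Num.max (a 0 i) (c 0 i)), (\row_i Num.min (b 0 i) (d 0 i)).
apply/seteqP; split => [v [h1 h2] i|v h].
  by rewrite !mxE ge_max le_min; move: (h1 i) (h2 i) => /andP[-> ->] /andP[-> ->].
split => i; have := h i; rewrite !mxE ge_max le_min.
  by move=> /andP[/andP[-> _] /andP[-> _]].
by move=> /andP[/andP[_ ->] /andP[_ ->]].
Qed.

Let cube (k : nat) : set Rn := box (const_mx (- k%:R)) (const_mx k%:R).

Lemma bigcup_cube : \bigcup_k cube k = setT.
Proof.
apply/seteqP; split=> // v _; exists (Num.truncn `|v|).+1 => //= i.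
rewrite !mxE -ler_norml (le_trans (coord_le_norm v i))// ltW//.
exact: truncnS_gt.
Qed.

(** Boxes generate the Borel sets: coordinates are measurable for the sigma-algebra
    they generate, since a half-space is a union of boxes, and hence so is the
    identity. *)
Lemma measurable_rV_box : (measurable : set (set Rn)) = <<s boxes >>.
Proof.
apply/seteqP; split; last first.
  apply: smallest_sub; first exact: sigma_algebra_measurable.
  by move=> _ [a [b ->]]; exact: measurable_box_rV.
pose T := g_sigma_algebraType boxes.
have mid : measurable_fun [set: T] (fun t : T => t : Rn).
  apply: measurable_fun_rV => i.
  apply: (measurability _ (measurable_realfun.RGenCInfty.measurableE R)) => _ [_ [c ->]] <-.
  rewrite setTI.
  have -> : (fun t : T => (t : Rn) 0 i) @^-1` `[c, +oo[ =
      \bigcup_k box (\row_j (if j == i then c else - k%:R)) (const_mx k%:R).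
    apply/seteqP; split => [v /=|v [k _] /(_ i)] /=.
      rewrite in_itv /= andbT => cv; exists (Num.truncn `|v|).+1 => //= j.
      have := coord_le_norm v j; have := truncnS_gt `|v|.
      rewrite !mxE => h1 h2; have := le_trans h2 (ltW h1).
      by rewrite ler_norml => /andP[]; case: eqP => [->|_] h3 h4; rewrite ?cv ?h3 h4.
    by rewrite !mxE eqxx in_itv /= andbT => /andP[].
  apply: bigcupT_measurable => k; apply: sub_sigma_algebra.
  by do 2 eexists.
move=> A mA; have := mid measurableT A mA; rewrite setTI; exact.
Qed.

Lemma box_eq0 (a b : Rn) : ~ (forall i, a 0 i <= b 0 i) -> box a b = set0.
Proof.
move=> nab; apply/seteqP; split => // v h; apply: nab => i.
by have /andP[h1 h2] := h i; exact: le_trans h2.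
Qed.

Lemma measurable_affine (s : R) (p : Rn) :
  measurable_fun [set: Rn] (fun x : Rn => s *: x + p : Rn).
Proof.
apply: measurable_fun_rV => i; under eq_fun do rewrite !mxE.
apply: measurable_funD; last exact: measurable_cst.
apply: measurable_funM; first exact: measurable_cst.
exact: measurable_coord_rV.
Qed.

(** Both sides are measures in A that agree on boxes. *)
Lemma lebesgue_rV_affine (s : R) (p : Rn) (A : set Rn) : 0 < s -> measurable A ->
  lebesgue_rV R n ((fun x : Rn => s *: x + p) @^-1` A) =
  ((s^-1 ^+ n)%:E * lebesgue_rV R n A)%E.
Proof.
move=> s0 mA.
have s1 : 0 <= s^-1 ^+ n by rewrite exprn_ge0// invr_ge0 ltW.
pose m1' : {measure set Rn -> \bar R} :=
  pushforward (lebesgue_rV R n) (fun x : Rn => s *: x + p).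
pose m1 : {measure set Rn -> \bar R} := m1' (measurable_affine s p).
pose m2 : {measure set Rn -> \bar R} := mscale (NngNum s1) (lebesgue_rV R n).
suff : m1 A = m2 A by [].
apply: (measure_unique boxes cube) => //.
- exact: measurable_rV_box.
- exact: boxesI.
- by move=> k; do 2 eexists.
- exact: bigcup_cube.
- move=> _ [a [b ->]]; rewrite /m1 /m2 /= /mscale /pushforward /=.
  have -> : (fun x : Rn => s *: x + p) @^-1` box a b =
     box (s^-1 *: (a - p)) (s^-1 *: (b - p)).
    apply/seteqP; split => v h i; have := h i; rewrite !mxE.
      move=> /andP[h1 h2].
      by rewrite ler_pdivrMl// ler_pdivlMl//; apply/andP; split; lra.
    move=> /andP[]; rewrite ler_pdivrMl// ler_pdivlMl// => h1 h2.
    by apply/andP; split; lra.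
  have [ab|nab] := pselect (forall i, a 0 i <= b 0 i).
    rewrite !lebesgue_rV_box//; last first.
      by move=> i; rewrite !mxE ler_wpM2l ?lerB// invr_ge0 ltW.
    rewrite -EFinM; congr (_%:E).
    under eq_bigr do rewrite !mxE -mulrBr opprB addrA subrK.
    by rewrite big_split/= prodr_const card_ord.
  rewrite (box_eq0 nab) box_eq0 ?measure0 ?mule0//.
  move=> ab; apply: nab => i; have := ab i.
  by rewrite !mxE ler_pM2l ?invr_gt0// lerD2r.
- move=> k; have := @lebesgue_rV_box R n (s^-1 *: (const_mx (- k%:R) - p))
    (s^-1 *: (const_mx k%:R - p)).
  rewrite /m1 /=/pushforward /=.
  have -> : (fun x : Rn => s *: x + p) @^-1` cube k = box (s^-1 *: (const_mx (- k%:R) - p))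
    (s^-1 *: (const_mx k%:R - p)).
    apply/seteqP; split => v h i; have := h i; rewrite !mxE.
      move=> /andP[h1 h2].
      by rewrite ler_pdivrMl// ler_pdivlMl//; apply/andP; split; lra.
    move=> /andP[]; rewrite ler_pdivrMl// ler_pdivlMl// => h1 h2.
    by apply/andP; split; lra.
  move=> ->; first by rewrite ltry.
  move=> i; rewrite !mxE ler_wpM2l ?invr_ge0 ?(ltW s0)// lerD2r.
  by rewrite -subr_ge0 opprK addr_ge0.
Qed.

Lemma lebesgue_rV_gt0 : (0 < lebesgue_rV R n setT)%E.
Proof.
apply: (@lt_le_trans _ _ (lebesgue_rV R n (cube 1))).
  rewrite lebesgue_rV_box; last by move=> i; rewrite !mxE; lra.
  by rewrite lte_fin prodr_gt0// => i _; rewrite !mxE; lra.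
by apply: le_measure; rewrite ?inE//; exact: measurable_box_rV.
Qed.

Lemma ge0_integral_affine (s : R) (p : Rn) (F : Rn -> \bar R) : 0 < s ->
  measurable_fun setT F -> (forall x, 0 <= F x)%E ->
  (\int[lebesgue_rV R n]_x F (s *: x + p)%R =
   (s^-1 ^+ n)%:E * \int[lebesgue_rV R n]_x F x)%E.
Proof.
move=> s0 mF F0.
have s1 : 0 <= s^-1 ^+ n by rewrite exprn_ge0// invr_ge0 ltW.
pose m1' : {measure set Rn -> \bar R} :=
  pushforward (lebesgue_rV R n) (fun x : Rn => s *: x + p).
pose m1 : {measure set Rn -> \bar R} := m1' (measurable_affine s p).
pose m2 : {measure set Rn -> \bar R} := mscale (NngNum s1) (lebesgue_rV R n).
transitivity (\int[m1]_x F x)%E.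
  by rewrite (ge0_integral_pushforward (measurable_affine s p)).
transitivity (\int[m2]_x F x)%E; last by rewrite /m2 ge0_integral_mscale.
apply: eq_measure_integral => A mA _; exact: lebesgue_rV_affine.
Qed.

End box_generation.

(** * Measurability and exponential integrability *)

Section measurability.
Context {R : realType} {n : nat}.
Local Notation Rn := 'rV[R]_n.

Lemma lsc_measurable (f : Rn -> \bar R) :
  lower_semicontinuous f -> measurable_fun setT f.
Proof.
move=> lf; apply: (measurability _ (ErealGenOInfty.measurableE R)).
move=> /= _ [_ [a ->]] <-; rewrite setTI; apply: sub_sigma_algebra.
by rewrite preimage_itvoy; move/lower_semicontinuousP : lf; exact.
Qed.

Lemma continuous_measurable (V : Rn -> R) :
  continuous V -> measurable_fun setT V.
Proof.
move=> cV; apply: (measurability _ (measurable_realfun.RGenOpens.measurableE R)).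
move=> _ [_ [a [b ->]] <-]; rewrite setTI; apply: sub_sigma_algebra.
by apply: open_comp; [move=> v _; exact: cV|exact: interval_open].
Qed.

Lemma measurable_expN (f : Rn -> \bar R) :
  measurable_fun setT f -> measurable_fun setT (fun x => expeR (- f x)%E).
Proof.
move=> mf; have mg : measurable_fun setT (fun x => - f x)%E by exact: measurableT_comp.
apply: (measurability _ (ErealGenOInfty.measurableE R)) => _ [_ [a ->]] <-.
rewrite setTI preimage_itvoy.
have [a0|a0] := ltP a 0.
  rewrite [X in measurable X](_ : _ = setT)//; apply/seteqP; split=> // x _ /=.
  by rewrite (lt_le_trans _ (expeR_ge0 _))// lte_fin.
set l := lne a%:E.
have lE : a%:E = expeR l by rewrite /l lneK// in_itv /= leey andbT lee_fin.
rewrite [X in measurable X](_ : _ = [set x | (l < - f x)%E]).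
  by rewrite -(setTI [set _ | _]); apply: emeasurable_fun_o_infty.
by apply/seteqP; split => x /=; rewrite lE lte_expeR.
Qed.

Lemma expeR_EFinN (r : R) : expeR (- r%:E)%E = (expR (- r))%:E.
Proof. by []. Qed.

End measurability.

Section exp_integrable.
Context {R : realType}.
Local Open Scope ereal_scope.

Lemma integral_expN_abs (b : R) : (0 < b)%R ->
  \int[@lebesgue_measure R]_t (expR (- (b * `|t|)))%:E < +oo.
Proof.
move=> b0; have cf : continuous (fun t : R => expR (- (b * `|t|))).
  move=> t; apply: continuous_comp; last exact: continuous_expR.
  by apply: cvgN; apply: cvgM; [exact: cvg_cst|exact: norm_continuous].
rewrite ge0_symfun_integralT//; last by move=> t; rewrite /= normrN.
apply: lte_mul_pinfty; [by rewrite lee_fin|by []|].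
apply: (@le_lt_trans _ _
  ((b^-1)%:E * \int[@lebesgue_measure R]_x (exponential_pdf b x)%:E)).
  rewrite -ge0_integralZl//; last 3 first.
    by apply/measurable_EFinP; exact: measurable_exponential_pdf.
    by move=> x _; rewrite lee_fin exponential_pdf_ge0// ltW.
    by rewrite lee_fin invr_ge0 ltW.
  rewrite [leLHS]integral_mkcond; apply: ge0_le_integral => //.
  - by move=> x _; apply: erestrict_ge0 => {}x _; rewrite lee_fin expR_ge0.
  - apply/measurable_restrict => //; first by rewrite -set_itvcy.
    by apply/measurable_funTS/measurable_EFinP; exact: continuous_measurable_fun.
  - apply: measurable_funeM; apply/measurable_EFinP; exact: measurable_exponential_pdf.
  - move=> x _; rewrite patchE; case: ifPn => [|_].
      rewrite inE /= => x0; rewrite /exponential_pdf patchE ifT ?inE/= ?in_itv/= ?x0//.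
      by rewrite -EFinM lee_fin mulrA mulVf ?gt_eqF// mul1r ger0_norm// mulNr.
    by rewrite mule_ge0// lee_fin ?invr_ge0 ?exponential_pdf_ge0// ltW.
by rewrite integral_exponential_pdf// mule1 ltry.
Qed.

Let E n (b : R) (x : 'rV[R]_n) : R := expR (- (b * \sum_i `|x 0 i|)).

Lemma measurable_E n b : measurable_fun setT (EFin \o @E n b).
Proof.
have cs : continuous (fun x : 'rV[R]_n => \sum_i `|x 0 i| : R)%R.
  apply: continuous_big => [|i _ y]; first exact: add_continuous.
  apply: (@continuous_comp _ _ _ (fun v : 'rV[R]_n => v 0%R i) Num.norm).
    exact: coord_continuous.
  exact: norm_continuous.
apply/measurable_EFinP; apply: continuous_measurable => x.
apply: continuous_comp; last exact: continuous_expR.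
exact: (cvgN (cvgM (cvg_cst _) (cs x))).
Qed.

Lemma integral_E n b : (0 < b)%R -> \int[lebesgue_rV R n]_x (E b x)%:E < +oo.
Proof.
move=> b0; elim: n => [|n IHn].
  have -> : \int[lebesgue_rV R 0]_x (E b x)%:E =
      \int[dirac (0%R : 'rV[R]_0)]_x (E b x)%:E by [].
  by rewrite integral_dirac// ?diracT ?mul1e ?ltry//; exact: measurable_E.
have -> : \int[lebesgue_rV R n.+1]_x (E b x)%:E =
   \int[pushforward (lebesgue_rV R n \x @lebesgue_measure R) (@rV_cons R n)]_x
     (E b x)%:E by [].
rewrite (ge0_integral_pushforward (@measurable_rV_cons R n))//; last 2 first.
  exact: measurable_E.
  by move=> x _; rewrite lee_fin expR_ge0.
rewrite preimage_setT.
have mE : measurable_fun setT ((fun x => (E b x)%:E) \o @rV_cons R n).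
  by apply: measurableT_comp; [exact: measurable_E|exact: measurable_rV_cons].
rewrite fubini_tonelli1//; last by move=> x; rewrite lee_fin expR_ge0.
have -> : fubini_F (@lebesgue_measure R) ((fun x => (E b x)%:E) \o @rV_cons R n) =
  (fun v => (\int[@lebesgue_measure R]_t (expR (- (b * `|t|)))%:E) * (E b v)%:E).
  apply/funext => v; rewrite /fubini_F muleC -ge0_integralZl//; last 2 first.
  - apply/measurable_EFinP; apply: continuous_measurable_fun => t.
    apply: continuous_comp; last exact: continuous_expR.
    exact: (cvgN (cvgM (cvg_cst _) (@norm_continuous _ _ t))).
  - by rewrite lee_fin expR_ge0.
  apply: eq_integral => t _ /=; rewrite -EFinM /E -expRD big_ord_recl.
  congr (expR _)%:E; rewrite !mxE unlift_none /=.
  under eq_bigr do rewrite mxE liftK /=.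
  by rewrite mulrDr opprD addrC.
rewrite ge0_integralZl//; last 3 first.
- exact: measurable_E.
- by move=> x _; rewrite lee_fin expR_ge0.
- by apply: integral_ge0 => t _; rewrite lee_fin expR_ge0.
apply: lte_mul_pinfty => //.
- by apply: integral_ge0 => t _; rewrite lee_fin expR_ge0.
- rewrite ge0_fin_numE ?integral_expN_abs//.
  by apply: integral_ge0 => t _; rewrite lee_fin expR_ge0.
Qed.

(** The sup norm dominates the average of the |x_i|, which turns the integrand into
    a product of one-dimensional exponentials. *)
Lemma integral_expN_norm n (a b : R) : (0 < a)%R ->
  \int[lebesgue_rV R n]_x (expR (b - a * `|x|))%:E < +oo.
Proof.
move=> a0.
(* dividing by n + 1 rather than n also covers dimension 0 *)
set d := (a / n.+1%:R)%R; have d0 : (0 < d)%R by rewrite divr_gt0.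
apply: (@le_lt_trans _ _ ((expR b)%:E * \int[lebesgue_rV R n]_x (E d x)%:E)).
  rewrite -ge0_integralZl//; last 2 first.
    exact: measurable_E.
    by move=> x _; rewrite lee_fin expR_ge0.
  apply: ge0_le_integral => //.
  - apply/measurable_EFinP; apply: continuous_measurable => x.
    apply: continuous_comp; last exact: continuous_expR.
    exact: (cvgB (cvg_cst _) (cvgM (cvg_cst _) (@norm_continuous _ _ x))).
  - by apply: measurable_funeM; exact: measurable_E.
  - move=> x _; rewrite -EFinM lee_fin /E -expRD ler_expR lerD2l lerN2.
    rewrite /d mulrAC ler_pdivrMr// -mulrA ler_wpM2l ?(ltW a0)//.
    have -> : (`|x| * n.+1%:R = `|x| + \sum_(i < n) `|x|)%R.
      by rewrite sumr_const card_ord -natr1 mulrDr mulr1 mulr_natr addrC.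
    apply: (@le_trans _ _ (\sum_(i < n) `|x|)%R); last by rewrite lerDr.
    by apply: ler_sum => i _; exact: coord_le_norm.
apply: lte_mul_pinfty => //; exact: integral_E.
Qed.

End exp_integrable.

(** * Linear growth of integrable log-concave densities *)

Section growth.
Context {R : realType} {n : nat}.
Local Notation Rn := 'rV[R]_n.
Local Notation leb := (lebesgue_rV R n).
Local Open Scope ereal_scope.

(** A far point p of D would carry too much volume: the sets t_j p + (1 - t_j) C
    with t_j = j / (2 N + 2), j <= N, lie in D, have at least 2^-n times the measure
    of C, and are pairwise disjoint once |p| is large compared with N times the
    radius of C. *)
Lemma finite_measure_convex_bounded (C D : set Rn) (rho : R) :
  measurable C -> measurable D -> C `<=` D -> (forall x, C x -> `|x| <= rho)%R ->
  0 < leb C -> leb D < +oo ->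
  (forall p c (t : R), D p -> C c -> (0 <= t <= 1)%R -> D (t *: p + (1 - t) *: c)%R) ->
  exists L : R, forall p, D p -> (`|p| <= L)%R.
Proof.
move=> mC mD CD Crho C0 Doo star.
have Cfin : leb C \is a fin_num.
  by rewrite ge0_fin_numE// (le_lt_trans _ Doo)// le_measure// inE.
have Dfin : leb D \is a fin_num by rewrite ge0_fin_numE.
set m := fine (leb C); have m0 : (0 < m)%R by rewrite fine_gt0// C0 ltey_eq Cfin.
set M := fine (leb D).
pose h := (2^-1 ^+ n * m)%R; have h0 : (0 < h)%R by rewrite mulr_gt0// exprn_gt0// invr_gt0.
pose N := Num.truncn (M / h).
have rho0 : (0 <= rho)%R.
  rewrite leNgt; apply/negP => rho0; move: C0.
  suff -> : C = set0 by rewrite measure0 ltxx.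
  apply/seteqP; split => // x /Crho h'.
  by have := le_lt_trans h' rho0; rewrite ltNge normr_ge0.
exists (4 * rho * N.+1%:R)%R => p Dp; rewrite leNgt; apply/negP => pL.
pose t (j : nat) : R := (j%:R / (2 * N.+1%:R))%R.
have t12 (j : 'I_N.+1) : (0 <= t j <= 2^-1)%R.
  rewrite divr_ge0//= ler_pdivrMr// mulrA mulVf// mul1r ler_nat ltnW//.
pose S (j : 'I_N.+1) :=
  (fun x : Rn => (1 - t j)^-1 *: x + (- ((1 - t j)^-1 * t j)) *: p)%R @^-1` C.
have t1 (j : 'I_N.+1) : (0 < 1 - t j)%R by have /andP[? ?] := t12 j; lra.
have mS j : measurable (S j).
  by rewrite -(setTI (S j)); apply: measurable_affine.
have SE j x : S j x -> exists2 c, C c & x = (t j *: p + (1 - t j) *: c)%R.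
  move=> Sx; exists ((1 - t j)^-1 *: x + (- ((1 - t j)^-1 * t j)) *: p)%R => //.
  rewrite scalerDr !scalerA mulfV ?lt0r_neq0// scale1r mulrN mulrA mulfV ?lt0r_neq0//.
  by rewrite mul1r scaleNr addrC subrK.
have SD j : S j `<=` D.
  move=> x /SE[c Cc ->]; apply: star => //.
  by have /andP[? ?] := t12 j; apply/andP; split; lra.
have lebS j : (h%:E <= leb (S j)).
  rewrite lebesgue_rV_affine//; last by rewrite invr_gt0.
  rewrite invrK -(fineK Cfin) -EFinM lee_fin (ler_wpM2r (ltW m0))//.
  have /andP[t0 t2] := t12 j; apply: lerXn2r; rewrite ?nnegrE ?invr_ge0//; first exact: ltW.
  by move: t2; clear; lra.
have tS : trivIset setT S.
  apply/trivIsetP => i j _ _ ij; apply/seteqP; split => // x [/SE[c Cc xi] /SE[d Cd xj]].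
  have H : ((t i - t j) *: p = (1 - t j) *: d - (1 - t i) *: c)%R.
    apply/rowP => k; have := congr1 (fun v : Rn => v 0%R k) xj.
    by rewrite xi !mxE => {}H; lra.
  have tij : ((2 * N.+1%:R)^-1 <= `|t i - t j|)%R.
    have e0 : (0 <= (2 * N.+1%:R)^-1 :> R)%R by rewrite invr_ge0.
    rewrite /t -mulrBl normrM (ger0_norm e0) ler_peMl//.
    have := ij; rewrite neq_ltn => /orP[] lt.
      rewrite distrC ger0_norm ?subr_ge0 ?ler_nat 1?ltnW//.
      by rewrite -natrB ?ler1n ?subn_gt0// ltnW.
    rewrite ger0_norm ?subr_ge0 ?ler_nat 1?ltnW//.
    by rewrite -natrB ?ler1n ?subn_gt0// ltnW.
  have := congr1 Num.norm H; rewrite normrZ => Hn.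
  have h1 : (`|(1 - t j) *: d - (1 - t i) *: c| <= rho + rho)%R.
    apply: (le_trans (ler_normB _ _)); rewrite !normrZ !gtr0_norm//.
    have cr := Crho _ Cc; have dr := Crho _ Cd.
    have /andP[ti _] := t12 i; have /andP[tj _] := t12 j.
    by apply: lerD; [apply: le_trans dr|apply: le_trans cr];
      rewrite ler_piMl// lerBlDr lerDl.
  have h2 : ((2 * N.+1%:R)^-1 * `|p| <= rho + rho)%R.
    by apply: le_trans h1; rewrite -Hn ler_wpM2r.
  move: h2; rewrite mulrC ler_pdivrMr// => h2.
  by move: h2 pL; clear; lra.
have : \sum_(j < N.+1) leb (S j) <= leb D.
  rewrite -measure_semi_additive_ord//; last by apply: bigsetU_measurable.
  apply: le_measure; rewrite ?inE//; first exact: bigsetU_measurable.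
  by move=> x; rewrite -bigcup_mkord_ord => -[j _]; exact: SD.
apply/negP; rewrite -ltNge.
apply: (@lt_le_trans _ _ (\sum_(j < N.+1) h%:E)); last by apply: lee_sum.
rewrite sumEFin sumr_const card_ord -(fineK Dfin) lte_fin -/M.
by rewrite -mulr_natl -ltr_pdivrMr// truncnS_gt.
Qed.

Section fun_growth.
Variables (g : Rn -> \bar R) (y0 : Rn) (c : R).
Hypothesis lg : lower_semicontinuous g.
Hypothesis cg : convex_ereal g.
Hypothesis ag : affine_minorant g y0 c.

Let cube (k : nat) : set Rn := box (const_mx (- k%:R)%R) (const_mx k%:R%R).

Let sublevel (M : R) : set Rn := [set x | g x <= M%:E].

Lemma measurable_sublevel M : measurable (sublevel M).
Proof.
rewrite -[sublevel M]setTI.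
by apply: emeasurable_fun_infty_c => //; exact: lsc_measurable.
Qed.

Lemma sublevel_convex (M : R) p q (t : R) : sublevel M p -> sublevel M q ->
  (0 <= t <= 1)%R -> sublevel M (t *: p + (1 - t) *: q)%R.
Proof.
move=> gp gq /andP[t0 t1]; rewrite /sublevel /=.
move: t0; rewrite le_eqVlt => /predU1P[<-|t0]; first by rewrite subr0 scale0r add0r scale1r.
move: t1; rewrite le_eqVlt => /predU1P[->|t1]; first by rewrite subrr scale0r addr0 scale1r.
apply: (le_trans (cg _ _ _)); first by rewrite t0 t1.
apply: (@le_trans _ _ (t%:E * M%:E + (1 - t)%:E * M%:E)).
  by apply: leeD; rewrite lee_pmul2l//= lte_fin subr_gt0.
by rewrite -!EFinM -EFinD lee_fin; lra.
Qed.

Lemma sublevel_lty (M : R) : expN_integral g < +oo -> leb (sublevel M) < +oo.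
Proof.
move=> goo; have : (expR (- M))%:E * leb (sublevel M) <= expN_integral g.
  rewrite -integral_cst; last exact: measurable_sublevel.
  apply: (@le_trans _ _ (\int[leb]_(x in sublevel M) expeR (- g x))).
    apply: ge0_le_integral => //.
    - exact: measurable_sublevel.
    - by move=> x _; rewrite lee_fin expR_ge0.
    - by apply: measurable_funTS; apply: measurable_expN; exact: lsc_measurable.
    - by move=> x; rewrite /sublevel /= => gx; rewrite -expeR_EFinN lee_expeR leeN2.
  apply: ge0_subset_integral => //.
  - exact: measurable_sublevel.
  - by apply: measurable_expN; exact: lsc_measurable.
  - by move=> x _; exact: expeR_ge0.
move=> /le_lt_trans /(_ goo); apply: contraTT; rewrite -!leNgt !leye_eq => /eqP ->.
by rewrite gt0_muley// lte_fin expR_gt0.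
Qed.

(** Otherwise the domain of g, a countable union of such sets, would be
    negligible. *)
Lemma sublevel_gt0 : 0 < expN_integral g -> exists k : nat,
  0 < leb (sublevel k%:R%R `&` cube k).
Proof.
move=> g0; apply: contrapT => nk.
pose S k := sublevel k%:R%R `&` cube k.
have mS k : measurable (S k).
  by apply: measurableI; [exact: measurable_sublevel|exact: measurable_box_rV].
have S0 k : leb (S k) = 0.
  apply/eqP; rewrite -measure_le0 leNgt; apply/negP => h; apply: nk; by exists k.
have : leb.-negligible (\bigcup_k S k).
  by apply: negligible_bigcup => k; apply/(negligibleP leb (mS k)); exact: S0.
have mU : measurable (\bigcup_k S k) by exact: bigcupT_measurable.
move=> /(negligibleP leb mU) U0.
move: g0; rewrite /expN_integral.
rewrite (ge0_negligible_integral mU)//; last 2 first.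
- by apply: measurable_expN; exact: lsc_measurable.
- by move=> x _; exact: expeR_ge0.
rewrite integral0_eq ?ltxx// => x [_ nSx].
suff -> : g x = +oo by [].
apply: contrapT => gx; apply: nSx.
have gfin : g x \is a fin_num.
  by rewrite fin_numE (minorant_gtNy ag); apply/eqP.
have [k1 _ k1x] : (\bigcup_k cube k) x.
  by rewrite /cube bigcup_cube.
pose k := maxn k1 (Num.truncn `|fine (g x)|%R).+1.
exists k => //; split.
  rewrite /sublevel /= -(fineK gfin) lee_fin (le_trans (ler_norm _))//.
  apply: ltW; apply: lt_le_trans (truncnS_gt _) _; rewrite ler_nat leq_maxr//.
move=> i; have := k1x i; rewrite !mxE => /andP[h1 h2].
have kk : (k1%:R <= k%:R :> R)%R by rewrite ler_nat leq_maxl.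
by apply/andP; split; lra.
Qed.

(** A sublevel set of level k + 1 has finite measure, so it is bounded.  From a point
    y of level k, the function g has to gain at least 1 to leave it, hence grows at
    least linearly after that, by convexity along rays. *)
Lemma convex_growth : 0 < expN_integral g -> expN_integral g < +oo ->
  exists a b : R, (0 < a)%R /\ forall x, (a * `|x| - b)%:E <= g x.
Proof.
move=> g0 goo; have [k C0] := sublevel_gt0 g0.
set C := (X in 0 < leb X) in C0.
have mC : measurable C.
  by apply: measurableI; [exact: measurable_sublevel|exact: measurable_box_rV].
have subk : sublevel k%:R%R `<=` sublevel (k%:R + 1)%R.
  by move=> x; rewrite /sublevel /= => /le_trans; apply; rewrite lee_fin lerDl.
have Ck x : C x -> (`|x| <= k%:R)%R.
  move=> [_ bx]; apply: norm_le_coord => // i.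
  by rewrite ler_norml; have := bx i; rewrite !mxE.
have [L LP] : exists L : R, forall p, sublevel (k%:R + 1)%R p -> (`|p| <= L)%R.
  apply: (@finite_measure_convex_bounded C _ k%:R%R) => //.
  - exact: measurable_sublevel.
  - by move=> x [/subk].
  - exact: sublevel_lty.
  - by move=> p q t Dp [/subk Dq _] t01; exact: sublevel_convex.
have [y Cy] : C !=set0.
  by apply/set0P/eqP => C00; move: C0; rewrite C00 measure0 ltxx.
have gy : g y <= (k%:R : R)%R%:E by case: Cy.
have gyf : g y \is a fin_num.
  by rewrite fin_numE (minorant_gtNy ag) lt_eqF// (le_lt_trans gy)// ltry.
have yk := Ck _ Cy.
have L0 : (0 <= L)%R by apply: le_trans (LP y _) => //; apply: subk; case: Cy.
have k0 : (0 <= k%:R :> R)%R by [].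
pose L2 := (L + k%:R + 1)%R; have L20 : (0 < L2)%R by rewrite /L2; lra.
pose B := (n%:R * (L2 + k%:R) * `|y0| + `|c|)%R.
have B0 : (0 <= B)%R by rewrite addr_ge0// !mulr_ge0// addr_ge0// ltW.
exists L2^-1%R, (B + (L2^-1 * (L2 + k%:R)))%R; split; first by rewrite invr_gt0.
move=> x; have xy : (`|x| <= `|x - y| + k%:R)%R.
  by rewrite -{1}(subrK y x) (le_trans (ler_normD _ _))// lerD2l.
have i0 : (0 < L2^-1)%R by rewrite invr_gt0.
have ixy := ler_wpM2l (ltW i0) xy.
have iL : (L2^-1 * L2 = 1)%R by rewrite mulVf// lt0r_neq0.
have [s1|s1] := ltP `|x - y|%R L2.
  apply: le_trans (ag x); rewrite lee_fin.
  have h1 := dot_le_norm x y0.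
  have h2 : (n%:R * `|x| * `|y0| <= n%:R * (L2 + k%:R) * `|y0|)%R.
    by rewrite ler_wpM2r// ler_wpM2l//; lra.
  have h3 := ler_norm (- dot x y0); rewrite normrN in h3; have h4 := ler_norm c.
  have h5 : (L2^-1 * `|x| <= L2^-1 * (L2 + k%:R))%R by rewrite ler_wpM2l ?ltW//; lra.
  rewrite /B; lra.
have [gx|gx] := eqVneq (g x) +oo; first by rewrite gx leey.
have gxf : g x \is a fin_num by rewrite fin_numE gx (minorant_gtNy ag).
set s := `|x - y|%R in s1 xy ixy.
have s0 : (0 < s)%R by exact: lt_le_trans s1.
(* z is the point of the segment from y to x at distance L2 from y *)
pose t := (L2 / s)%R.
have t0 : (0 < t)%R by rewrite divr_gt0.
have t1 : (t <= 1)%R by rewrite ler_pdivrMr// mul1r.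
pose z := (t *: x + (1 - t) *: y)%R.
have zE : z = (y + t *: (x - y))%R by apply/rowP => i; rewrite /z !mxE; ring.
have zL : (L < `|z|)%R.
  have : (`|t *: (x - y)| <= `|z| + `|y|)%R.
    have -> : (t *: (x - y) = z - y)%R by rewrite zE addrAC subrr add0r.
    exact: ler_normB.
  rewrite normrZ gtr0_norm// -/s /t divfK ?lt0r_neq0// /L2; lra.
have zD : ~ sublevel (k%:R + 1)%R z by move=> /LP; rewrite leNgt zL.
have gz : (k%:R + 1)%:E < t%:E * g x + (1 - t)%:E * g y.
  rewrite ltNge; apply/negP => h; apply: zD; rewrite /sublevel /=.
  have [t1'|t1'] := eqVneq t 1%R.
    move: h; rewrite /z t1' subrr scale0r addr0 scale1r mul1e mul0e adde0//.
  by apply: le_trans h; apply: cg; rewrite t0 lt_neqAle t1' t1.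
move: gz gy; rewrite -(fineK gxf) -(fineK gyf) -!EFinM -EFinD lte_fin !lee_fin.
move: (fine (g x)) (fine (g y)) => a b h1 h2.
have h3 : ((1 - t) * b <= (1 - t) * k%:R)%R by rewrite ler_wpM2l// subr_ge0.
have h4 : (1 < t * (a - k%:R))%R by lra.
have h5 : (L2^-1 * s < a - k%:R)%R.
  have : (t^-1 * 1 < t^-1 * (t * (a - k%:R)))%R by rewrite ltr_pM2l ?invr_gt0.
  by rewrite mulr1 mulrA mulVf ?lt0r_neq0// mul1r /t invf_div mulrC.
rewrite mulrDr iL; rewrite mulrDr in ixy; lra.
Qed.

End fun_growth.
End growth.

(** * Probability measures with a density *)

Section density.
Context d (T : measurableType d) (R : realType).
Variable mu : {sigma_finite_measure set T -> \bar R}.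
Local Open Scope ereal_scope.

Section construction.
Variable f : T -> R.
Hypotheses (mf : measurable_fun setT f) (f0 : forall x, (0 <= f x)%R).
Hypothesis f1 : \int[mu]_x (f x)%:E = 1.

Definition density_set A := \int[mu]_(x in A) (f x)%:E.

Let density0 : density_set set0 = 0. Proof. exact: integral_set0. Qed.

Let density_ge0 A : 0 <= density_set A.
Proof. by apply: integral_ge0 => x _; rewrite lee_fin. Qed.

Let density_sigma_additive : semi_sigma_additive density_set.
Proof.
apply: semi_sigma_additive_nng_induced; first exact/measurable_EFinP.
by move=> x; rewrite lee_fin.
Qed.

HB.instance Definition _ := isMeasure.Build _ _ _ density_set
  density0 density_ge0 density_sigma_additive.

HB.instance Definition _ := Measure_isProbability.Build _ _ _ density_set f1.

Lemma density_probability :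
  exists P : probability T R, forall A, P A = \int[mu]_(x in A) (f x)%:E.
Proof. by exists (density_set : probability T R). Qed.

End construction.

Section calculus.
Variables (P : probability T R) (f : T -> R).
Hypothesis mf : measurable_fun setT f.
Hypothesis PE : forall A, measurable A -> P A = \int[mu]_(x in A) (f x)%:E.

Lemma density_dominated : P `<< mu.
Proof.
apply/null_content_dominatesP => A mA muA.
by rewrite PE// null_set_integral//; exact/measurable_funTS/measurable_EFinP.
Qed.

Lemma ge0_integral_density (h : T -> \bar R) :
  measurable_fun setT h -> (forall x, 0 <= h x) ->
  \int[P]_x h x = \int[mu]_x (h x * (f x)%:E).
Proof.
move=> mh h0.
have dom := density_dominated.
have int_g := Radon_Nikodym_SigmaFinite.f_integrable dom.
rewrite -(Radon_Nikodym_SigmaFinite.change_of_variables dom)//.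
apply: ae_eq_integral => //.
- apply: emeasurable_funM => //; exact: measurable_int int_g.
- by apply: emeasurable_funM => //; exact/measurable_EFinP.
- apply: ae_eqe_mul2l; apply: integral_ae_eq => //; first exact/measurable_EFinP.
  move=> A _ mA.
  exact: etrans (esym (Radon_Nikodym_SigmaFinite.f_integral dom mA)) (PE mA).
Qed.

(** Almost everywhere for P, which is all that the entropy sees. *)
Lemma Radon_Nikodym_density :
  ae_eq P setT (Radon_Nikodym (charge_of_finite_measure P) mu) (EFin \o f).
Proof.
have dom := density_dominated.
have dom' : charge_of_finite_measure P `<< mu by exact: dom.
apply: (null_dominates_ae_eq _ dom) => //.
apply: integral_ae_eq => //.
- exact: Radon_Nikodym_integrable.
- exact/measurable_EFinP.
- move=> A _ mA; exact: etrans (esym (Radon_Nikodym_integral dom' mA)) (PE mA).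
Qed.

End calculus.
End density.

Lemma measurable_lne (R : realType) d (T : measurableType d) (h : T -> \bar R) :
  measurable_fun setT h -> measurable_fun setT (fun x => lne (h x)).
Proof.
move=> mh; apply: (measurability _ (ErealGenOInfty.measurableE R)) => _ [_ [a ->]] <-.
rewrite preimage_itvoy.
have -> : [set x | (a%:E < lne (h x))%E] = [set x | ((expR a)%:E < h x)%E].
  apply/seteqP; split => x /=; case: (h x) => [r| |] //=.
  - case: ifPn => // r0; rewrite !lte_fin; rewrite -ltNge in r0.
    by rewrite -{2}(lnK r0) ltr_expR.
  - by rewrite !ltry.
  - rewrite lte_fin => ar; have r0 : 0 < r by apply: lt_trans ar; exact: expR_gt0.
    by rewrite leNgt r0 /= lte_fin -ltr_expR lnK.
  - by rewrite !ltry.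
exact: emeasurable_fun_o_infty.
Qed.

(** * Entropy and moment measure of a Gibbs measure *)

Section gibbs_theory.
Context {R : realType} {n : nat}.
Local Notation Rn := 'rV[R]_n.
Local Notation leb := (lebesgue_rV R n).
Local Open Scope ereal_scope.

Lemma limn_einf_le (u B : (\bar R)^nat) (L : \bar R) :
  (forall k, u k <= B k) -> B @ \oo --> L -> limn_einf u <= L.
Proof.
move=> uB BL; rewrite limn_einf_lim -(cvg_lim _ BL)//.
apply: lee_lim; first exact: is_cvg_einfs.
  by apply/cvg_ex; exists L.
apply: nearW => k; apply: le_trans (uB k).
by apply: ereal_inf_lbound; exists k => /=.
Qed.

Variables (V : Rn -> R) (p : Rn -> Rn) (C a b : R).
Hypothesis tV : tangent V p C.
Hypothesis a0 : (0 < a)%R.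
Hypothesis Vge : forall x, (a * `|x| - b <= V x)%R.

Let mV : measurable_fun setT V.
Proof. by apply: continuous_measurable; exact: tangent_continuous tV. Qed.

Let Vb x : (0 <= V x + b)%R.
Proof. by have := Vge x; have := mulr_ge0 (ltW a0) (normr_ge0 x); lra. Qed.

Let mexp : measurable_fun setT (fun x => expR (- V x))%R.
Proof.
by apply: measurableT_comp; [exact: measurable_expR|exact: measurable_funN].
Qed.

(** Each coordinate of [p] is a limit of difference quotients of V. *)
Lemma measurable_tangent_slope : measurable_fun setT (p : Rn -> Rn).
Proof.
apply: measurable_fun_rV => i.
pose e : Rn := delta_mx 0%R i.
have dotei x : dot e x = x 0%R i.
  rewrite /dot (bigD1 i)//= big1 ?addr0 => [|j ji]; first by rewrite !mxE !eqxx mul1r.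
  by rewrite mxE (negbTE ji) andbF mul0r.
pose h (k : nat) (x : Rn) : R := (k.+1%:R * (V (1 *: x + k.+1%:R^-1 *: e) - V x))%R.
apply: (@measurable_fun_cvg _ _ _ _ h).
  move=> k; apply: measurable_funM; first exact: measurable_cst.
  apply: measurable_funB => //.
  by apply: (measurableT_comp mV); exact: measurable_affine.
move=> x _.
apply: (@squeeze_cvgr _ _ _ _ (fun=> p x 0%R i) (fun k => p x 0%R i + C * k.+1%:R^-1)%R).
- apply: nearW => k; have k0 : (0 < k.+1%:R :> R)%R by [].
  have /andP[h1 h2] := tV x (k.+1%:R^-1 *: e).
  rewrite !dotZl !dotZr !dotei {3}/e !mxE !eqxx mulr1 in h1 h2.
  rewrite /h scale1r; set K := (k.+1%:R : R) in k0 h1 h2 *.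
  have KK : (K * K^-1 = 1)%R by rewrite mulfV// lt0r_neq0.
  have e1 : (K * (K^-1 * p x 0%R i) = p x 0%R i)%R by rewrite mulrA KK mul1r.
  have e2 : (K * (C * (K^-1 * K^-1)) = C * K^-1)%R by rewrite mulrCA (mulrA K) KK mul1r.
  have := ler_wpM2l (ltW k0) h1; have := ler_wpM2l (ltW k0) h2.
  by rewrite !mulrDr e1 ?e2; clearbody K => ? ?; apply/andP; split; lra.
- exact: cvg_cst.
- rewrite -[X in _ --> X]addr0; apply: cvgD; first exact: cvg_cst.
  rewrite -(mulr0 C); apply: cvgM; first exact: cvg_cst.
  exact: cvg_harmonic.
Qed.

Let Z := fine (expN_integral (EFin \o V)).

Lemma expN_integral_growth_lty : expN_integral (EFin \o V) < +oo.
Proof.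
apply: le_lt_trans (integral_expN_norm n b a0).
apply: ge0_le_integral => //.
- by move=> x _; exact: expeR_ge0.
- exact/measurable_EFinP.
- apply/measurable_EFinP; apply: continuous_measurable => x.
  apply: continuous_comp; last exact: continuous_expR.
  exact: (cvgB (cvg_cst _) (cvgM (cvg_cst _) (@norm_continuous _ _ x))).
- by move=> x _; rewrite lee_fin ler_expR; have := Vge x; lra.
Qed.

Lemma expN_integral_finite_gt0 : 0 < expN_integral (EFin \o V).
Proof.
have ge0 : 0 <= expN_integral (EFin \o V).
  by apply: integral_ge0 => x _; exact: expeR_ge0.
rewrite lt_neqAle ge0 andbT eq_sym; apply/eqP => I0.
have mE : measurable_fun setT (fun x : Rn => (expR (- V x))%:E) by exact/measurable_EFinP.
have := (ae_eq_integral_abs leb measurableT mE).1.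
have -> : \int[leb]_x `|(expR (- V x))%:E| = 0.
  by rewrite -I0; apply: eq_integral => x _; rewrite gee0_abs ?lee_fin ?expR_ge0.
move=> /(_ erefl) [N [mN N0 sN]].
have NT : N = setT.
  apply/seteqP; split => // x _; apply: sN => /= /(_ Logic.I) /eqP.
  by rewrite eqe gt_eqF// expR_gt0.
by move: N0; rewrite NT => T0; have := @lebesgue_rV_gt0 R n; rewrite T0 ltxx.
Qed.

Let Ifin : expN_integral (EFin \o V) \is a fin_num.
Proof.
by rewrite ge0_fin_numE ?expN_integral_growth_lty// ltW// expN_integral_finite_gt0.
Qed.

Let Z0 : (0 < Z)%R.
Proof. by rewrite fine_gt0// expN_integral_finite_gt0 expN_integral_growth_lty. Qed.

Let f x : R := (Z^-1 * expR (- V x))%R.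

Let mf : measurable_fun setT f.
Proof. by apply: measurable_funM => //; exact: measurable_cst. Qed.

Let f0 x : (0 < f x)%R.
Proof. by rewrite mulr_gt0// ?invr_gt0// expR_gt0. Qed.

Lemma gibbs_exists : exists eta : probability Rn R, gibbs V eta /\
  forall A, measurable A -> eta A = \int[leb]_(x in A) (f x)%:E.
Proof.
have fE A : measurable A -> \int[leb]_(x in A) (f x)%:E =
    (Z^-1)%:E * \int[leb]_(x in A) (expR (- V x))%:E.
  move=> mA; rewrite -ge0_integralZl//.
  - by apply: measurable_funTS; exact/measurable_EFinP.
  - by rewrite lee_fin invr_ge0 ltW.
have f1 : \int[leb]_x (f x)%:E = 1.
  rewrite fE// -[X in _ * X]/(expN_integral (EFin \o V)) -(fineK Ifin) -EFinM.
  by rewrite mulVf ?lt0r_neq0.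
have [eta etaE] := density_probability mf (fun x => ltW (f0 x)) f1.
exists eta; split => [A mA|A mA]; last exact: etaE.
by rewrite etaE fE.
Qed.

Section with_eta.
Variable eta : probability Rn R.
Hypothesis etaE : forall A, measurable A -> eta A = \int[leb]_(x in A) (f x)%:E.

Let gibbs_integral (h : Rn -> R) : measurable_fun setT h -> (forall x, 0 <= h x)%R ->
  \int[eta]_x (h x)%:E = (Z^-1)%:E * \int[leb]_x (h x * expR (- V x))%:E.
Proof.
move=> mh h0; have mh' : measurable_fun setT (EFin \o h) by exact/measurable_EFinP.
have mm : measurable_fun setT (fun x => (h x * expR (- V x))%:E).
  by apply/measurable_EFinP; exact: measurable_funM.
have hE0 x : 0 <= (h x)%:E by rewrite lee_fin.
have m0 x : 0 <= (h x * expR (- V x))%:E by rewrite lee_fin mulr_ge0// expR_ge0.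
have iZ : 0 <= (Z^-1)%:E by rewrite lee_fin invr_ge0 ltW.
rewrite (ge0_integral_density mf etaE mh' hE0).
rewrite -(ge0_integralZl leb measurableT mm (fun x _ => m0 x) iZ).
by apply: eq_integral => x _; rewrite -!EFinM mulrCA.
Qed.

(** With u = V + b, which is nonnegative, u exp (- u) <= 2 exp (- u / 2), and u
    grows linearly. *)
Lemma integral_shifted_lty : \int[eta]_x (V x + b)%:E < +oo.
Proof.
have mVb : measurable_fun setT (fun x => V x + b)%R.
  by apply: measurable_funD => //; exact: measurable_cst.
rewrite gibbs_integral//.
apply: lte_mul_pinfty => //; first by rewrite lee_fin invr_ge0 ltW.
have a20 : (0 < a / 2)%R by rewrite divr_gt0.
have := integral_expN_norm n (b + ln 2) a20.
apply: le_lt_trans; apply: ge0_le_integral => //.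
- by move=> x _; rewrite lee_fin mulr_ge0// expR_ge0.
- by apply/measurable_EFinP; exact: measurable_funM.
- apply/measurable_EFinP; apply: continuous_measurable => x.
  apply: continuous_comp; last exact: continuous_expR.
  exact: (cvgB (cvg_cst _) (cvgM (cvg_cst _) (@norm_continuous _ _ x))).
- move=> x _; rewrite lee_fin.
  have h1 := expR_ge1Dx ((V x + b) / 2)%R.
  have h2 : (V x + b <= 2 * expR ((V x + b) / 2))%R by lra.
  apply: (@le_trans _ _ (2 * expR ((V x + b) / 2) * expR (- V x))%R).
    by rewrite ler_wpM2r// expR_ge0.
  rewrite -{1}(@lnK R 2%R) ?posrE// -!expRD ler_expR.
  by have := Vge x; lra.
Qed.

Let E := fine (\int[eta]_x (V x)%:E).

Lemma gibbs_V_integrable : eta.-integrable setT (EFin \o V).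
Proof.
have -> : (EFin \o V) = ((fun x => (V x + b)%:E) \- (fun=> b%:E)).
  by apply/funext => x /=; rewrite -EFinB addrK.
apply: integrableB => //; last exact: finite_measure_integrable_cst.
apply/integrableP; split.
  by apply/measurable_EFinP; apply: measurable_funD => //; exact: measurable_cst.
under eq_integral do rewrite gee0_abs ?lee_fin//.
exact: integral_shifted_lty.
Qed.

Lemma gibbs_mean_fin : \int[eta]_x (V x)%:E = E%:E.
Proof. by rewrite fineK// integrable_fin_num// gibbs_V_integrable. Qed.

Let intD (k : R) : \int[eta]_x (V x + k)%:E = (E + k)%:E.
Proof.
under eq_integral do rewrite EFinD.
rewrite integralD//; last 2 first.
- exact: gibbs_V_integrable.
- exact: finite_measure_integrable_cst.
rewrite gibbs_mean_fin integral_cst// -[X in _ + _ * X]/(eta setT) probability_setT mule1.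
by rewrite EFinD.
Qed.

Lemma gibbs_entropy : entropy eta = (- E - ln Z)%:E.
Proof.
have aeq : ae_eq eta setT
   (fun x => lne (Radon_Nikodym (charge_of_finite_measure eta) leb x))
   (fun x => (- V x - ln Z)%:E).
  have [N [mN N0 sN]] := Radon_Nikodym_density mf etaE.
  exists N; split => // x nx; apply: sN => /= h; apply: nx => _.
  rewrite h//= leNgt f0 /= /f lnM ?posrE ?invr_gt0 ?expR_gt0//.
  by rewrite expRK lnV ?posrE// addrC.
have mm : measurable_fun setT (fun x => (- V x - ln Z)%:E).
  apply/measurable_EFinP; apply: measurable_funB; last exact: measurable_cst.
  exact: measurable_funN.
rewrite /entropy; transitivity (\int[eta]_x (- V x - ln Z)%:E).
  apply: ae_eq_integral => //.
  apply: measurable_lne; apply: measurable_int; apply: Radon_Nikodym_integrable.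
  exact: (density_dominated mf etaE).
have iV : eta.-integrable setT (EFin \o (fun x => V x + ln Z)%R).
  rewrite (_ : EFin \o _ = (EFin \o V) \+ (fun=> (ln Z)%:E)); last by apply/funext.
  apply: integrableD => //; first exact: gibbs_V_integrable.
  exact: finite_measure_integrable_cst.
under eq_integral do rewrite -opprD EFinN.
rewrite integralN; last exact: (integrable_add_def _ iV).
by rewrite intD -EFinN opprD.
Qed.

Section moment.
Variable W : Rn -> R.
Hypothesis WE : forall x, W (p x) = (dot x (p x) - V x)%R.
Hypothesis Wge : forall y, (- V 0%R <= W y)%R.
Hypothesis mW : measurable_fun setT W.

(** The mean of x . grad V x is at most n.  Here [h j x] is the difference
    quotient (V x - V (r x)) / (1 - r), with r < 1 tending to 1, minus V x - V 0:
    it is nonnegative by convexity and tends to W (p x) + V 0.  Its integral is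
    bounded using the substitution x -> r x, and Fatou's lemma concludes. *)
Lemma gibbs_conjugate_mean : \int[eta]_x (W (p x) + V 0%R)%:E <= (n%:R - E + V 0%R)%:E.
Proof.
pose s (j : nat) : R := (1 + j.+1%:R^-1)%R.
have s1 j : (1 < s j)%R by rewrite ltrDl invr_gt0.
have s0 j : (0 < s j)%R by apply: lt_trans (s1 j).
pose r j : R := (s j)^-1%R.
have r0 j : (0 < r j)%R by rewrite invr_gt0.
have r1 j : (r j < 1)%R by rewrite invf_lt1.
have r1' j : (0 < 1 - r j)%R by rewrite subr_gt0.
pose h j x : R := ((V x - V (r j *: x + 0)%R) / (1 - r j) - V x + V 0%R)%R.
have mVr j : measurable_fun setT (fun x : Rn => V (r j *: x + 0)%R).
  by apply: (measurableT_comp mV); exact: measurable_affine.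
have mh j : measurable_fun setT (h j).
  apply: measurable_funD; last exact: measurable_cst.
  apply: measurable_funB => //; apply: measurable_funM; last exact: measurable_cst.
  exact: measurable_funB.
have h0 j x : (0 <= h j x)%R.
  have := tangent_convex tV x 0%R (ltW (r0 j)) (ltW (r1 j)); rewrite scaler0.
  move=> hc; have : (V x - V 0%R <= (V x - V (r j *: x + 0)%R) / (1 - r j))%R.
    by rewrite ler_pdivlMr//; lra.
  rewrite /h; lra.
have cs : s j @[j --> \oo] --> (1 : R)%R.
  rewrite -[X in _ --> X](@addr0 R).
  by apply: cvgD; [exact: cvg_cst|exact: cvg_harmonic].
have cr : r j @[j --> \oo] --> (1:R)%R.
  rewrite -[X in _ --> X](@invr1 R).
  by apply: cvgV => //; exact: oner_neq0.
have hW x : h j x @[j --> \oo] --> (W (p x) + V 0%R)%R.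
  rewrite WE; apply: cvgD; last exact: cvg_cst.
  apply: cvgB; last exact: cvg_cst.
  apply: (@squeeze_cvgr _ _ _ _
    (fun j => dot x (p x) - C * dot x x * (1 - r j))%R (fun=> dot x (p x))).
  - apply: nearW => j; have /andP[h1 h2] := tV x (- (1 - r j) *: x)%R.
    have xE : (x + - (1 - r j) *: x = r j *: x + 0)%R.
      by rewrite addr0 -{1}(scale1r x) -scalerDl; congr (_ *: _); lra.
    rewrite xE !dotZl !dotZr in h1 h2.
    by rewrite ler_pdivrMr// ler_pdivlMr//; apply/andP; split; lra.
  - rewrite -[X in _ --> X]subr0 -(mulr0 (C * dot x x)%R) -(subrr (1:R)%R).
    apply: cvgB; first exact: cvg_cst.
    apply: cvgM; first exact: cvg_cst.
    by apply: cvgB => //; exact: cvg_cst.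
  - exact: cvg_cst.
have V0b : (0 <= V 0%R + b)%R by exact: Vb.
have bound j : \int[eta]_x (h j x)%:E <= (n%:R * s j ^+ n + V 0%R - E)%:E.
  (* [V x + b] and the constant are added to keep every integrand nonnegative;
     pointwise this is 1 + u <= exp u for u = V x - V (r x) *)
  have main : \int[eta]_x (h j x)%:E + (E + b)%:E + ((1 - r j)^-1)%:E <=
     ((1 - r j)^-1 * (s j ^+ n) + (V 0%R + b))%:E.
    have ir0 : (0 <= (1 - r j)^-1)%R by rewrite invr_ge0 ltW.
    have meV : measurable_fun setT (fun x : Rn => expR (- V (r j *: x + 0)%R)).
      apply: measurableT_comp; first exact: measurable_expR.
      exact: measurable_funN.
    have mk : measurable_fun setT (fun x : Rn => h j x + (V x + b) + (1 - r j)^-1)%R.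
      apply: measurable_funD; last exact: measurable_cst.
      apply: measurable_funD => //; apply: measurable_funD => //; exact: measurable_cst.
    have k0 x : (0 <= h j x + (V x + b) + (1 - r j)^-1)%R.
      by apply: addr_ge0 => //; apply: addr_ge0; [exact: h0|exact: Vb].
    have -> : \int[eta]_x (h j x)%:E + (E + b)%:E + ((1 - r j)^-1)%:E =
        \int[eta]_x (h j x + (V x + b) + (1 - r j)^-1)%:E.
      under [RHS]eq_integral do rewrite 2!EFinD.
      have A1 x : [set: Rn] x -> 0 <= (h j x)%:E by move=> _; rewrite lee_fin.
      have A2 x : [set: Rn] x -> 0 <= (V x + b)%:E by move=> _; rewrite lee_fin.
      have A3 x : [set: Rn] x -> 0 <= (h j x)%:E + (V x + b)%:E.
        by move=> _; rewrite -EFinD lee_fin addr_ge0.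
      have A4 x : [set: Rn] x -> 0 <= ((1 - r j)^-1)%:E by move=> _; rewrite lee_fin.
      have M1 : measurable_fun setT (fun x : Rn => (h j x)%:E) by exact/measurable_EFinP.
      have M2 : measurable_fun setT (fun x : Rn => (V x + b)%:E).
        by apply/measurable_EFinP; apply: measurable_funD => //; exact: measurable_cst.
      have M3 : measurable_fun setT (fun x : Rn => (h j x)%:E + (V x + b)%:E).
        exact: emeasurable_funD.
      rewrite ge0_integralD// ge0_integralD//.
      rewrite intD integral_cst// -[X in _ = _ + _ * X]/(eta setT).
      by rewrite probability_setT mule1.
    rewrite gibbs_integral//.
    have upper : \int[leb]_x ((h j x + (V x + b) + (1 - r j)^-1) * expR (- V x))%:E <=
      \int[leb]_x ((1 - r j)^-1%:E * (expR (- V (r j *: x + 0)%R))%:E +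
                   (V 0%R + b)%:E * (expR (- V x))%:E).
      apply: ge0_le_integral => //.
      - by move=> x _; rewrite lee_fin mulr_ge0// expR_ge0.
      - by apply/measurable_EFinP; exact: measurable_funM.
      - apply: emeasurable_funD; apply: measurable_funeM; exact/measurable_EFinP.
      - move=> x _; rewrite -!EFinM -EFinD lee_fin.
        have h1 := expR_ge1Dx (V x - V (r j *: x + 0))%R.
        have h2 : ((1 + (V x - V (r j *: x + 0))) * expR (- V x) <=
            expR (- V (r j *: x + 0)))%R.
          have -> : expR (- V (r j *: x + 0)%R) =
              (expR (V x - V (r j *: x + 0)%R) * expR (- V x))%R.
            by rewrite -expRD; congr expR; lra.
          by rewrite ler_wpM2r// expR_ge0.
        have := ler_wpM2l ir0 h2; rewrite /h; lra.
    apply: (le_trans (lee_wpmul2l _ upper)); first by rewrite lee_fin invr_ge0 ltW.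
    have A1 x : [set: Rn] x -> 0 <= (expR (- V (r j *: x + 0)%R))%:E.
      by move=> _; rewrite lee_fin expR_ge0.
    have A2 x : [set: Rn] x -> 0 <= (expR (- V x))%:E.
      by move=> _; rewrite lee_fin expR_ge0.
    have M1 : measurable_fun setT (fun x : Rn => (expR (- V (r j *: x + 0)%R))%:E).
      exact/measurable_EFinP.
    have M2 : measurable_fun setT (fun x : Rn => (expR (- V x))%:E).
      exact/measurable_EFinP.
    have B1 x : [set: Rn] x -> 0 <= (1 - r j)^-1%:E * (expR (- V (r j *: x + 0)%R))%:E.
      by move=> xT; rewrite mule_ge0// A1.
    have B2 x : [set: Rn] x -> 0 <= (V 0%R + b)%:E * (expR (- V x))%:E.
      by move=> xT; rewrite mule_ge0// A2.
    have N1 := measurable_funeM ((1 - r j)^-1)%:E M1.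
    have N2 := measurable_funeM (V 0%R + b)%:E M2.
    rewrite ge0_integralD// !ge0_integralZl//.
    rewrite (@ge0_integral_affine R n (r j) 0%R (fun x => (expR (- V x))%:E))//.
    have -> : \int[leb]_x (expR (- V x))%:E = Z%:E by rewrite /Z fineK.
    rewrite -(EFinM (1 - r j)^-1%R) /r invrK /= lee_fin -/(r j).
    have ZZ : (Z^-1 * Z = 1)%R by rewrite mulVf// lt0r_neq0.
    set A := (1 - r j)^-1%R; set S := (s j ^+ n)%R; set B := (V 0%R + b)%R.
    have -> : (Z^-1 * (A * (S * Z) + B * Z) = Z^-1 * Z * (A * S + B))%R by ring.
    by rewrite ZZ mul1r.
  have If : \int[eta]_x (h j x)%:E \is a fin_num.
    rewrite ge0_fin_numE; last by apply: integral_ge0 => x _; rewrite lee_fin.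
    move: main; case: (\int[eta]_x (h j x)%:E) => [u| |]//=; first by rewrite ltry.
  move: main; rewrite -(fineK If) -!EFinD !lee_fin.
  move: (fine _) => I.
  (* Bernoulli's inequality for r j, multiplied by s j ^ n *)
  have key : ((s j ^+ n - 1) <= n%:R * s j ^+ n * (1 - r j))%R.
    have bern m : (1 - (r j) ^+ m <= m%:R * (1 - r j))%R.
      elim: m => [|m IH]; first by rewrite expr0 mul0r subrr.
      have rm : ((r j) ^+ m <= 1)%R by rewrite exprn_ile1// ltW.
      have := ler_wpM2r (ltW (r1' j)) rm.
      by rewrite exprS -natr1; lra.
    have sn : (0 < s j ^+ n)%R by rewrite exprn_gt0.
    have rs : (s j ^+ n * r j ^+ n = 1)%R by rewrite -exprMn /r mulfV ?expr1n// lt0r_neq0.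
    have := ler_wpM2l (ltW sn) (bern n); rewrite mulrBr mulr1 rs.
    by rewrite mulrCA mulrA.
  have : ((1 - r j)^-1 * (s j ^+ n) - (1 - r j)^-1 <= n%:R * s j ^+ n)%R.
    rewrite -{2}(mulr1 (1 - r j)^-1%R) -mulrBr ler_pdivrMl//.
    by rewrite mulrC.
  lra.
apply: (@le_trans _ _ (limn_einf (fun j => \int[eta]_x (h j x)%:E))).
  have -> : (fun x => (W (p x) + V 0%R)%:E) = (fun x => limn_einf (fun j => (h j x)%:E)).
    apply/funext => x; have hx : (h j x)%:E @[j --> \oo] --> (W (p x) + V 0%R)%:E.
      by apply: cvg_EFin; [exact: nearW|exact: hW].
    rewrite is_cvg_limn_einfE ?(cvg_lim _ hx)//; apply/cvg_ex; by eexists; exact: hx.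
  apply: fatou => //.
    by move=> j; exact/measurable_EFinP.
  by move=> j x _; rewrite lee_fin.
apply: (limn_einf_le bound).
apply: cvg_EFin; first exact: nearW.
have -> : (n%:R - E + V 0%R = n%:R * 1 ^+ n + V 0%R - E)%R by rewrite expr1n; lra.
apply: cvgB; last exact: cvg_cst.
apply: cvgD; last exact: cvg_cst.
apply: cvgM; first exact: cvg_cst.
exact: (cvg_comp _ _ cs (@exprn_continuous R n 1%R)).
Qed.

(** W is admissible without being integrable a priori: it is bounded below by
    - V 0, so the change of variables is made for W + V 0. *)
Lemma moment_exists : exists nu : probability Rn R,
  moment_measure V eta nu /\ \int[nu]_y (W y)%:E <= (n%:R - E)%:E.
Proof.
pose P : {mfun Rn >-> Rn} := HB.pack p
  (isMeasurableFun.Build _ _ _ _ p measurable_tangent_slope).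
exists (distribution eta P : probability Rn R); split.
  move=> A mA; rewrite /distribution /pushforward /=; congr (eta _).
  apply/seteqP; split => x /=.
    move=> Ax; rewrite (tangent_gradient tV); split=> //.
    by have [] := tangent_is_diff tV x.
  by rewrite (tangent_gradient tV) => -[].
set nu := (distribution eta P : probability Rn R).
have W0 y : (0 <= W y + V 0)%R by have := Wge y; lra.
have mW0 : measurable_fun setT (fun y => W y + V 0)%R.
  by apply: measurable_funD => //; exact: measurable_cst.
have pushE : \int[nu]_y (W y + V 0)%:E = \int[eta]_x (W (p x) + V 0)%:E.
  rewrite (ge0_integral_pushforward measurable_tangent_slope)//.
    exact/measurable_EFinP.
  by move=> y _; rewrite lee_fin.
have bound := gibbs_conjugate_mean; rewrite -pushE in bound.
have iW0 : nu.-integrable setT (EFin \o (fun y => W y + V 0)%R).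
  apply/integrableP; split; first exact/measurable_EFinP.
  under eq_integral do rewrite /= ger0_norm//.
  exact: le_lt_trans bound (ltry _).
have -> : (fun y => (W y)%:E) = (fun y => (W y + V 0)%:E - (V 0)%:E).
  by apply/funext => y; rewrite -EFinB addrK.
rewrite integralB//; last exact: finite_measure_integrable_cst.
rewrite integral_cst// -[X in _ - _ * X]/(nu setT) probability_setT mule1.
by rewrite leeBlDr// -EFinD.
Qed.

End moment.
End with_eta.

Lemma gibbs_moment_bounds (W : Rn -> R) :
  (forall x, W (p x) = dot x (p x) - V x)%R -> (forall y, - V 0%R <= W y)%R ->
  measurable_fun setT W ->
  exists (E : R) (eta nu : probability Rn R),
  [/\ gibbs V eta, moment_measure V eta nu,
      entropy eta = (- E - ln (fine (expN_integral (EFin \o V))))%:E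
    & \int[nu]_y (W y)%:E <= (n%:R - E)%:E].
Proof.
move=> WE Wge mW; have [eta [geta etaE]] := gibbs_exists.
have [nu [mnu nuW]] := moment_exists etaE WE Wge mW.
exists (fine (\int[eta]_x (V x)%:E)), eta, nu; split => //.
exact: gibbs_entropy.
Qed.

End gibbs_theory.

(** * The inverse Santalo inequality *)

Section smooth_pairs.
Context {R : realType} {n : nat}.
Local Notation Rn := 'rV[R]_n.
Local Open Scope ereal_scope.

Definition transport_bound (c : R) (V : Rn -> R) :=
  forall eta etas nu nus : probability Rn R,
  gibbs V eta -> gibbs (legendreR V) etas ->
  moment_measure V eta nu -> moment_measure (legendreR V) etas nus ->
  entropy eta + entropy etas <=
    (- (n%:R * ln (c * expR 2)))%:E + Tcost nu nus.

(** With W := U in [gibbs_moment_bounds] for V, and V in that for U, the means of V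
    and U cancel on both sides of the transport bound. *)
Lemma transport_bound_santalo (c : R) (V U : Rn -> R) p q (C D a b a' b' : R) :
  (0 < c)%R -> tangent V p C -> tangent U q D ->
  (0 < a)%R -> (forall x, a * `|x| - b <= V x)%R ->
  (0 < a')%R -> (forall x, a' * `|x| - b' <= U x)%R ->
  legendre (EFin \o V) = EFin \o U -> legendre (EFin \o U) = EFin \o V ->
  transport_bound c V ->
  (c ^+ n)%:E <= expN_integral (EFin \o V) * expN_integral (EFin \o U).
Proof.
move=> c0 tV tU a0 Vge a'0 Uge VU UV bound.
have VRU : legendreR V = U by apply/funext => y; rewrite /legendreR VU.
have Up x : U (p x) = (dot x (p x) - V x)%R.
  by apply: EFin_inj; rewrite -(tangent_legendre tV) VU.
have Vq x : V (q x) = (dot x (q x) - U x)%R.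
  by apply: EFin_inj; rewrite -(tangent_legendre tU) UV.
have Uge0 y : (- V 0%R <= U y)%R.
  have := legendre_ge (EFin \o V) 0%R y.
  by rewrite VU dot0l /= lee_fin sub0r.
have Vge0 y : (- U 0%R <= V y)%R.
  have := legendre_ge (EFin \o U) 0%R y.
  by rewrite UV dot0l /= lee_fin sub0r.
have mV := continuous_measurable (tangent_continuous tV).
have mU := continuous_measurable (tangent_continuous tU).
have [E [eta [nu [geta mnu Heta Tnu]]]] := gibbs_moment_bounds tV a0 Vge Up Uge0 mU.
have [E' [etas [nus [getas mnus Hetas Tnus]]]] := gibbs_moment_bounds tU a'0 Uge Vq Vge0 mV.
have := bound eta etas nu nus geta; rewrite VRU => /(_ getas mnu mnus).
have Tle : Tcost nu nus <= (n%:R - E)%:E + (n%:R - E')%:E.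
  apply: (@le_trans _ _ (\int[nu]_y (U y)%:E + \int[nus]_y (V y)%:E)); last exact: leeD.
  apply: ereal_inf_lbound; exists (EFin \o U); first exact: tangent_FRn tU.
  by rewrite UV.
move=> /le_trans /(_ (leeD (lexx _) Tle)); rewrite Heta Hetas.
have pos V' p' C' a1 b1 : tangent V' p' C' -> (0 < a1)%R ->
    (forall x : Rn, a1 * `|x| - b1 <= V' x)%R ->
    expN_integral (EFin \o V') \is a fin_num /\
    (0 < fine (expN_integral (EFin \o V')))%R.
  move=> tV' a10 V'ge.
  have lty := expN_integral_growth_lty tV' a10 V'ge.
  have gt0 := expN_integral_finite_gt0 tV'.
  by split; [rewrite ge0_fin_numE ?lty// ltW|rewrite fine_gt0// gt0 lty].
have [Zfin Z0] := pos _ _ _ _ _ tV a0 Vge.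
have [Z'fin Z'0] := pos _ _ _ _ _ tU a'0 Uge.
rewrite -(fineK Zfin) -(fineK Z'fin) /= !lee_fin.
move: (fine _) Z0 (fine _) Z'0 => Z Z0 Z' Z'0.
rewrite lnM ?posrE ?expR_gt0// expRK => H.
rewrite -ler_ln ?posrE ?exprn_gt0 ?mulr_gt0// lnM ?posrE// lnXn// -mulr_natl.
lra.
Qed.

End smooth_pairs.

Section approximation.
Context {R : realType} {n : nat}.
Local Notation Rn := 'rV[R]_n.
Local Notation leb := (lebesgue_rV R n).
Local Open Scope ereal_scope.

Let eps (k : nat) : R := k.+1%:R^-1%R.

Let eps0 k : (0 < eps k)%R. Proof. by rewrite invr_gt0. Qed.

Let eps1 k : (eps k <= 1)%R. Proof. by rewrite invf_le1// ler1n. Qed.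

Let eps_nincr k l : (k <= l)%N -> (eps l <= eps k)%R.
Proof. by move=> kl; rewrite lef_pV2 ?posrE// ler_nat ltnS. Qed.

Lemma le_add_quad (e1 e2 : R) (h : Rn -> \bar R) x : (e1 <= e2)%R ->
  add_quad e1 h x <= add_quad e2 h x.
Proof.
by move=> e12; rewrite /add_quad leeD2l// lee_fin ler_wpM2r// dot_ge0.
Qed.

Lemma add_quad_ge (e : R) (h : Rn -> \bar R) x : (0 <= e)%R -> h x <= add_quad e h x.
Proof. by move=> e0; rewrite /add_quad leeDl// lee_fin mulr_ge0// dot_ge0. Qed.

Section pointwise.
Variable h : Rn -> \bar R.
Hypothesis hNy : forall x, h x != -oo.

Lemma legendre_add_quad_sup y :
  ereal_sup (range (fun k => legendre (add_quad (eps k) h) y)) = legendre h y.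
Proof.
apply/eqP; rewrite eq_le; apply/andP; split.
  apply: ge_ereal_sup => _ [k _ <-]; apply: le_legendre => x.
  by apply: add_quad_ge; exact: ltW.
apply: legendre_le => x; have := hNy x.
case hx : (h x) => [r| |]//= _; last by rewrite leNye.
apply/lee_addgt0Pr => e e0.
pose d := dot x x; have d0 : (0 <= d)%R := dot_ge0 x.
pose k := Num.truncn (d / e).
have kd : (eps k * d <= e)%R.
  by rewrite /eps mulrC ler_pdivrMr// mulrC -ler_pdivrMr// ltW// truncnS_gt.
apply: (@le_trans _ _ (legendre (add_quad (eps k) h) y + e%:E)).
  apply: le_trans (leeD (legendre_ge (add_quad (eps k) h) x y) (lexx _)).
  by rewrite /add_quad hx /= lee_fin -/d; lra.
by rewrite leeD2r//; apply: ereal_sup_ubound; exists k.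
Qed.

(** The sequence is nonincreasing, so its limit is its infimum; going through the
    logarithm identifies it also where the conjugate is infinite. *)
Lemma expN_legendre_cvg y :
  expeR (- legendre (add_quad (eps k) h) y) @[k --> \oo] --> expeR (- legendre h y).
Proof.
set u := fun k => expeR (- legendre (add_quad (eps k) h) y).
have ndu : {homo u : k l / (k <= l)%N >-> k >= l}.
  move=> k l kl; rewrite lee_expeR leeN2; apply: le_legendre => x.
  by apply: le_add_quad; exact: eps_nincr.
have -> : expeR (- legendre h y) = ereal_inf (range u).
  apply/eqP; rewrite eq_le; apply/andP; split.
    apply: le_ereal_inf_tmp => _ [k _ <-]; rewrite lee_expeR leeN2.
    by apply: le_legendre => x; apply: add_quad_ge; exact: ltW.
  set m := ereal_inf _; have [m0|m0] := ltP m 0.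
    by rewrite (le_trans (ltW m0))// expeR_ge0.
  have <- : expeR (lne m) = m by rewrite lneK// in_itv /= leey m0.
  rewrite lee_expeR leeNr -legendre_add_quad_sup.
  apply: ge_ereal_sup => _ [k _ <-]; rewrite leeNr -lee_expeR.
  rewrite lneK; last by rewrite in_itv /= leey m0.
  by apply: ereal_inf_lbound; exists k.
exact: ereal_nonincreasing_cvgn.
Qed.

End pointwise.

Lemma expN_integral_cvg (h : Rn -> \bar R) (a b : R) : (forall x, h x != -oo) ->
  (0 < a)%R -> (forall x, (a * `|x| - b)%:E <= legendre (add_quad 1 h) x) ->
  expN_integral (legendre h) \is a fin_num /\
  expN_integral (legendre (add_quad (eps k) h)) @[k --> \oo] --> expN_integral (legendre h).
Proof.
move=> hNy a0 growth.
have mL (g : Rn -> \bar R) : measurable_fun setT (fun y => expeR (- legendre g y) : \bar R).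
  by apply: measurable_expN; apply: lsc_measurable; exact: legendre_lsc.
have mG : measurable_fun setT (fun x : Rn => (expR (b - a * `|x|))%:E).
  apply/measurable_EFinP; apply: continuous_measurable => x.
  apply: continuous_comp; last exact: continuous_expR.
  exact: (cvgB (cvg_cst _) (cvgM (cvg_cst _) (@norm_continuous _ _ x))).
have intG : leb.-integrable setT (fun x : Rn => (expR (b - a * `|x|))%:E).
  apply/integrableP; split => //.
  under eq_integral do rewrite gee0_abs ?lee_fin ?expR_ge0//.
  exact: integral_expN_norm.
have dom : {ae leb, forall y k, setT y ->
    `|expeR (- legendre (add_quad (eps k) h) y)| <= (expR (b - a * `|y|))%:E}.
  apply: aeW => y k _; rewrite gee0_abs ?expeR_ge0//.
  rewrite -[leRHS]/(expeR (b - a * `|y|)%R%:E) lee_expeR leeNl -EFinN opprB.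
  by apply: (le_trans (growth y)); apply: le_legendre => x; exact: le_add_quad.
have cv : {ae leb, forall y, setT y ->
    expeR (- legendre (add_quad (eps k) h) y) @[k --> \oo] --> expeR (- legendre h y)}.
  by apply: aeW => y _; exact: expN_legendre_cvg.
have [intf _ cvgI] := @dominated_convergence _ _ _ leb setT measurableT
  (fun k y => expeR (- legendre (add_quad (eps k) h) y)) _ _
  (fun k => mL _) (mL _) cv intG dom.
by split; first exact: integrable_fin_num.
Qed.

(** The conjugate f of g is at most b where n |x| <= a; testing the conjugate of
    f + |.|^2 against the vertex of a small cube with the signs of y gives linear
    growth in y. *)
Lemma legendre_growth (f g : Rn -> \bar R) (a b : R) : (0 < a)%R ->
  (forall y, (a * `|y| - b)%:E <= g y) -> f = legendre g ->
  exists a' b' : R, (0 < a')%R /\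
    forall y, (a' * `|y| - b')%:E <= legendre (add_quad 1 f) y.
Proof.
move=> a0 gge fE; pose rho := (a / n.+1%:R)%R.
have rho0 : (0 < rho)%R by rewrite divr_gt0.
exists rho, (b + n%:R * rho ^+ 2)%R; split => // y.
pose x : Rn := (\row_i (rho * Num.sg (y ord0 i)))%R.
have xi i : (`|x 0%R i| <= rho)%R.
  rewrite mxE normrM gtr0_norm// ler_piMr ?(ltW rho0)// normr_sg.
  by case: (_ != _).
have fx : f x <= b%:E.
  rewrite fE; apply: legendre_le_affine => z; apply: le_trans (gge z); rewrite lee_fin.
  have h1 := dot_le_norm z x; have h2 := ler_norm (dot z x).
  have h3 : (`|x| <= rho)%R by apply: norm_le_coord => //; exact: ltW.
  have h4 : (n%:R * `|x| <= a)%R.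
    apply: (@le_trans _ _ (n.+1%:R * rho)%R); first by rewrite ler_pM// ler_nat.
    by rewrite /rho mulrC divfK.
  have h5 : (n%:R * `|z| * `|x| <= a * `|z|)%R by rewrite mulrAC ler_wpM2r.
  lra.
have dxy : (rho * `|y| <= dot x y)%R.
  have -> : dot x y = (rho * \sum_i `|y 0%R i|)%R.
    rewrite /dot mulr_sumr; apply: eq_bigr => i _.
    by rewrite mxE -mulrA -normrEsg.
  rewrite (ler_wpM2l (ltW rho0))//; apply: norm_le_coord => [|i]; first exact: sumr_ge0.
  by rewrite (bigD1 i)//= lerDl sumr_ge0.
have dxx : (dot x x <= n%:R * rho ^+ 2)%R.
  have -> : (n%:R * rho ^+ 2 = \sum_(i < n) rho ^+ 2)%R.
    by rewrite sumr_const card_ord mulr_natl.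
  apply: ler_sum => i _; rewrite -expr2 -real_normK ?num_real//.
  by rewrite lerXn2r ?nnegrE// ltW.
apply: le_trans (legendre_ge _ x y); rewrite /add_quad mul1r.
move: fx; case: (f x) => [r| |] //=; last by rewrite leey.
by rewrite !lee_fin; lra.
Qed.

(** The predicate [P] carries a symmetry of f, here none or evenness, over to the
    approximations V_k, which are the functions submitted to [P] in the last
    hypothesis before the two integrals. *)
Lemma santalo_approximation (P : (Rn -> R) -> Prop) (c : R)
    (f : Rn -> \bar R) : (0 < c)%R ->
  (forall V : Rn -> R, VRn V -> P V -> transport_bound c V) ->
  FRn f ->
  (forall e : R,
    P (fun x => fine (legendre (add_quad e (legendre f)) x) + e * dot x x)%R) ->
  0 < expN_integral f -> 0 < expN_integral (legendre f) ->
  (c ^+ n)%:E <= expN_integral f * expN_integral (legendre f).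
Proof.
move=> c0 bound [fNy [x1 f1] cf lf] Pf If0 Ig0.
have [Ify|Ify] := eqVneq (expN_integral f) +oo.
  by rewrite Ify gt0_mulye// leey.
have [Igy|Igy] := eqVneq (expN_integral (legendre f)) +oo.
  by rewrite Igy gt0_muley// leey.
set g := legendre f in Pf Ig0 Igy *.
have f1y : f x1 < +oo by rewrite ltey_eq f1.
have gNy y : g y != -oo by exact: legendre_gtNy f1y.
have [y1 g1y] : exists y1, g y1 < +oo.
  apply: contrapT => ng; move: Ig0; rewrite /expN_integral integral0_eq ?ltxx// => y _.
  suff -> : g y = +oo by [].
  by apply/eqP; rewrite -leye_eq leNgt; apply/negP => gy; apply: ng; exists y.
have g1 : g y1 \is a fin_num by rewrite fin_numE gNy lt_eqF.
have lg : lower_semicontinuous g by exact: legendre_lsc.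
have cg : convex_ereal g by exact: legendre_convex f1y.
have ag : affine_minorant g x1 (fine (f x1)) by exact: legendre_minorant.
have af : affine_minorant f y1 (fine (g y1)).
  move=> x; have := legendre_ge f x y1; rewrite -/g -(fineK g1).
  by case: (f x) (fNy x) => [r| |]//= _; rewrite ?leey// !lee_fin; lra.
have fE : legendre g = f by exact: (biconjugate lf cf af f1y).
have [a1 [b1 [a10 gge]]] : exists a b : R, (0 < a)%R /\ forall x, (a * `|x| - b)%:E <= g x.
  by apply: (convex_growth lg cg ag) => //; rewrite ltey.
have [a2 [b2 [a20 fge]]] : exists a b : R, (0 < a)%R /\ forall x, (a * `|x| - b)%:E <= f x.
  by apply: (convex_growth lf cf af) => //; rewrite ltey.
have [a3 [b3 [a30 Fge]]] := legendre_growth a10 gge (esym fE).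
have [a4 [b4 [a40 Gge]]] := legendre_growth a20 fge (erefl g).
have [Ffin Fcvg] := expN_integral_cvg fNy a30 Fge.
have [Gfin Gcvg] := expN_integral_cvg gNy a40 Gge.
rewrite -/g in Ffin Fcvg; rewrite fE in Gfin Gcvg.
have main k : (c ^+ n)%:E <= expN_integral (legendre (add_quad (eps k) g)) *
    expN_integral (legendre (add_quad (eps k) f)).
  set e := eps k; have e0 : (0 < e)%R by exact: eps0.
  have [W [p [WE tW]]] := conj_tangent lg cg ag g1y e0.
  pose V x := (W x + e * dot x x)%R.
  have tV := tangent_add_quad tW (ltW e0).
  have VE : EFin \o V = add_quad e (EFin \o W) by apply/funext.
  have Wge x : (a4 * `|x| - b4 <= W x)%R.
    rewrite -lee_fin -[leRHS]/((EFin \o W) x) -WE; apply: (le_trans (Gge x)).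
    by apply: le_legendre => y; apply: le_add_quad; exact: eps1.
  have Vge x : (a4 * `|x| - b4 <= V x)%R.
    by apply: (le_trans (Wge x)); rewrite lerDl mulr_ge0 ?dot_ge0// ltW.
  have minor (V' : Rn -> R) : (forall x, a4 * `|x| - b4 <= V' x)%R ->
      affine_minorant (EFin \o V') 0%R b4.
    move=> V'ge x; rewrite dot0r /= lee_fin.
    by have := V'ge x; have := mulr_ge0 (ltW a40) (normr_ge0 x); lra.
  have [_ _ cW lW] := tangent_FRn tW.
  have [_ _ cV lV] := tangent_FRn tV.
  have [U [q [UE tU]]] := conj_tangent lW cW (minor _ Wge) (ltry (W 0%R)) e0.
  rewrite -VE in UE.
  have UV : legendre (EFin \o U) = EFin \o V.
    by rewrite -UE; exact: (biconjugate lV cV (minor _ Vge) (ltry (V 0%R))).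
  have VF x : (EFin \o V) x <= add_quad e f x.
    rewrite VE /add_quad leeD2r// -WE -fE; apply: le_legendre => y.
    by apply: add_quad_ge; exact: ltW.
  have Ufge y : legendre (add_quad e f) y <= (U y)%:E.
    by rewrite -[leRHS]/((EFin \o U) y) -UE; exact: le_legendre.
  have Uge x : (a3 * `|x| - b3 <= U x)%R.
    rewrite -lee_fin; apply: le_trans (Ufge x); apply: (le_trans (Fge x)).
    by apply: le_legendre => y; apply: le_add_quad; exact: eps1.
  have bV : transport_bound c V.
    apply: bound.
      split; first exact: tangent_convex_function tV.
      by move=> y; rewrite UE.
    have -> : V = (fun x => fine (legendre (add_quad e g) x) + e * dot x x)%R by rewrite WE.
    exact: Pf.
  apply: le_trans (transport_bound_santalo c0 tV tU a40 Vge a30 Uge UE UV bV) _.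
  have mE (h : Rn -> \bar R) : lower_semicontinuous h ->
      measurable_fun setT (fun x => expeR (- h x)).
    by move=> lh; apply: measurable_expN; exact: lsc_measurable.
  have Ige0 h : 0 <= @expN_integral R n h by apply: integral_ge0 => x _; exact: expeR_ge0.
  have [_ _ _ lU] := tangent_FRn tU.
  apply: lee_pmul => //; apply: ge0_le_integral => //.
  - by move=> x _; exact: expeR_ge0.
  - exact: mE.
  - by apply: mE; exact: legendre_lsc.
  - by move=> x _; rewrite lee_expeR leeN2 WE /= lee_fin lerDl mulr_ge0 ?dot_ge0// ltW.
  - by move=> x _; exact: expeR_ge0.
  - exact: mE.
  - by apply: mE; exact: legendre_lsc.
  - by move=> x _; rewrite lee_expeR leeN2.
have lim : expN_integral (legendre (add_quad (eps k) g)) *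
    expN_integral (legendre (add_quad (eps k) f)) @[k --> \oo] -->
    expN_integral f * expN_integral g.
  by apply: cvgeM => //; exact: mule_def_fin.
rewrite -(cvg_lim _ lim)//; apply: lime_ge.
  by apply/cvg_ex; eexists; exact: lim.
by apply: nearW => k; exact: main.
Qed.

End approximation.

Theorem corollary2p4 (R : realType) (n : nat) (c : R) :
  (0 < n)%N -> 0 < c ->
  ((forall V : 'rV[R]_n -> R, VRn V ->
     forall eta etas nu nus : probability 'rV[R]_n R,
     gibbs V eta -> gibbs (legendreR V) etas ->
     moment_measure V eta nu -> moment_measure (legendreR V) etas nus ->
     (entropy eta + entropy etas <=
      (- (n%:R * ln (c * expR 2)))%:E + Tcost nu nus)%E) ->
   IS n c)
  /\
  ((forall V : 'rV[R]_n -> R, VRn V -> evenf V ->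
     forall eta etas nu nus : probability 'rV[R]_n R,
     gibbs V eta -> gibbs (legendreR V) etas ->
     moment_measure V eta nu -> moment_measure (legendreR V) etas nus ->
     (entropy eta + entropy etas <=
      (- (n%:R * ln (c * expR 2)))%:E + Tcost nu nus)%E) ->
   ISs n c).
Proof.
move=> n0 c0; split => [bound f Ff _|bound f Ff ef].
  by apply: (@santalo_approximation _ _ (fun=> True)) => // V VV _; exact: bound.
apply: (@santalo_approximation _ _ (@evenf R n R)) => // e x.
rewrite (legendre_even _) ?dotNl ?dotNr ?opprK// => y.
by rewrite /add_quad (legendre_even ef) dotNl dotNr opprK.
Qed.
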